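(* Let $E$ be an arbitrary directed graph and $K$ any field. The following are equivalent for the Leavitt path algebra $L=L_K(E)$: (i) $L$ has at most finitely many non-isomorphic simple left (equivalently, right) $L$-modules; (ii) $L$ is a semi-artinian ring with finitely many two-sided ideals.
   Context: A directed graph $E=(E^0,E^1,r,s)$ consists of a set $E^0$ of vertices, a set $E^1$ of edges and maps $r,s:E^1\to E^0$ (range and source); there are no restrictions on the cardinalities of $E^0$, $E^1$ or of the sets $s^{-1}(v)$. A vertex $v$ is regular if $0<|s^{-1}(v)|<\infty$. Given a field $K$, the Leavitt path algebra $L_K(E)$ is the (not necessarily unital) $K$-algebra generated by pairwise orthogonal idempotents $\{v:v\in E^0\}$ and elements $\{e,e^*:e\in E^1\}$ subject to: (1) $s(e)e=e=er(e)$; (2) $r(e)e^*=e^*=e^*s(e)$; (3) $e^*e=r(e)$ and $e^*f=0$ for edges $e\ne f$; (4) $v=\sum_{e\in E^1,\,s(e)=v}ee^*$ for every regular vertex $v$. The algebra $L_K(E)$ has a standard involution exchanging $e$ and $e^*$, so left and right simple modules correspond. A left module $S$ over a ring $R$ (not necessarily unital) is simple if $RS\neq 0$ and $S$ has no submodules other than $0$ and $S$; similarly for right modules. $L$ is semi-artinian if its socular (Loewy) chain reaches $L$: define $S_0=0$, $S_{\alpha+1}/S_\alpha=\mathrm{Soc}(L/S_\alpha)$ (the socle, i.e. the sum of all simple left ideals of the ring $L/S_\alpha$), and $S_\gamma=\bigcup_{\alpha<\gamma}S_\alpha$ for limit ordinals $\gamma$; then $L=S_\lambda$ for some ordinal $\lambda$.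 *)

(* Defs.v *)
From HB Require Import structures.
From Stdlib Require Import List.
From mathcomp Require Import all_boot all_order all_algebra.
From mathcomp Require Import generic_quotient ring_quotient.
From mathcomp Require Import wochoice all_classical.

Set Implicit Arguments.
Unset Strict Implicit.
Unset Printing Implicit Defensive.

Import GRing.Theory.
Local Open Scope classical_set_scope.
Local Open Scope quotient_scope.
Local Open Scope ring_scope.

HB.mixin Record Zmodule_isRng R of GRing.Zmodule R := {
  rmul : R -> R -> R;
  rmulA : associative rmul;
  rmulDl : left_distributive rmul +%R;
  rmulDr : right_distributive rmul +%R }.

#[short(type="rngType")]
HB.structure Definition Rng := {R of Zmodule_isRng R & GRing.Zmodule R}.

Notation "x ** y" := (rmul x y) (at level 40, left associativity) : ring_scope.

Section RngTheory.
Variable R : rngType.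
Implicit Types x y : R.

Lemma rmul0 x : x ** 0 = 0.
Proof. by apply: (addIr (x ** 0)); rewrite -rmulDr !add0r. Qed.

Lemma rmul0l x : 0 ** x = 0.
Proof. by apply: (addIr (0 ** x)); rewrite -rmulDl !add0r. Qed.

Lemma rmulN x y : x ** (- y) = - (x ** y).
Proof. by apply: (addIr (x ** y)); rewrite -rmulDr !addNr rmul0. Qed.

Lemma rmulNl x y : (- x) ** y = - (x ** y).
Proof. by apply: (addIr (x ** y)); rewrite -rmulDl !addNr rmul0l. Qed.

End RngTheory.

Definition opp_rng (R : Type) : Type := R.

Section OppRng.
Variable R : rngType.
Definition opp_rmul (x y : opp_rng R) : opp_rng R := (y : R) ** (x : R).
HB.instance Definition _ := GRing.Zmodule.on (opp_rng R).
Fact opp_rmulA : associative opp_rmul.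
Proof. by move=> x y z; rewrite /opp_rmul rmulA. Qed.
Fact opp_rmulDl : left_distributive opp_rmul +%R.
Proof. by move=> x y z; rewrite /opp_rmul rmulDr. Qed.
Fact opp_rmulDr : right_distributive opp_rmul +%R.
Proof. by move=> x y z; rewrite /opp_rmul rmulDl. Qed.
HB.instance Definition _ :=
  Zmodule_isRng.Build (opp_rng R) opp_rmulA opp_rmulDl opp_rmulDr.
End OppRng.

HB.mixin Record Zmodule_isRngModule (R : rngType) M of GRing.Zmodule M := {
  ract : R -> M -> M;
  ractA : forall a b x, ract a (ract b x) = ract (a ** b) x;
  ractDl : forall x, {morph ract^~ x : a b / a + b};
  ractDr : forall a, {morph ract a : x y / x + y} }.

(* These are left modules; right [R]-modules are left modules over [opp_rng R]. *)
#[short(type="rngModType")]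
HB.structure Definition RngModule (R : rngType) :=
  {M of Zmodule_isRngModule R M & GRing.Zmodule M}.

Definition regular_mod (R : Type) : Type := R.

Section RegularModule.
Variable R : rngType.
HB.instance Definition _ := GRing.Zmodule.on (regular_mod R).
Definition regular_act (a : R) (x : regular_mod R) : regular_mod R :=
  a ** (x : R).
Fact regular_actA (a b : R) (x : regular_mod R) :
  regular_act a (regular_act b x) = regular_act (a ** b) x.
Proof. exact: rmulA. Qed.
Fact regular_actDl (x : regular_mod R) : {morph regular_act^~ x : a b / a + b}.
Proof. by move=> a b; exact: rmulDl. Qed.
Fact regular_actDr (a : R) : {morph regular_act a : x y / x + y}.
Proof. by move=> x y; exact: rmulDr. Qed.
HB.instance Definition _ := Zmodule_isRngModule.Build R (regular_mod R)
  regular_actA regular_actDl regular_actDr.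
End RegularModule.

Section Simplicity.
Variable R : rngType.

Definition is_submodule (M : rngModType R) (N : set M) : Prop :=
  [/\ N 0, forall x y, N x -> N y -> N (x - y) &
      forall (a : R) x, N x -> N (ract a x)].

(* [N], viewed as an [R]-module of its own, is simple; the second clause says
   that [R N <> 0]. *)
Definition simple_submodule (M : rngModType R) (N : set M) : Prop :=
  [/\ is_submodule N,
      exists (a : R) (x : M), N x /\ ract a x <> 0 &
      forall N' : set M, is_submodule N' -> N' `<=` N ->
        N' = [set 0] \/ N' = N].

Definition simple_module (M : rngModType R) : Prop :=
  simple_submodule [set: M].

Definition module_iso (M N : rngModType R) : Prop :=
  exists f : {additive M -> N},
    bijective f /\ forall (a : R) (x : M), f (ract a x) = ract a (f x).

Definition finitely_many_simple_left_modules : Prop :=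
  exists (n : nat) (S : 'I_n -> rngModType R),
    (forall i, simple_module (S i)) /\
    forall M : rngModType R, simple_module M -> exists i, module_iso M (S i).

Definition socle : set R :=
  [set x | exists (n : nat) (y : 'I_n -> R),
     (forall i, exists I : set (regular_mod R), simple_submodule I /\ I (y i))
     /\ x = \sum_(i < n) y i].

End Simplicity.

Definition finitely_many_simple_right_modules (R : rngType) : Prop :=
  finitely_many_simple_left_modules (opp_rng R).

Definition is_ideal (R : rngType) (I : set R) : Prop :=
  [/\ I 0, forall x y, I x -> I y -> I (x - y) &
      forall a x, I x -> I (a ** x) /\ I (x ** a)].

Record ideal (R : rngType) := Ideal {
  ideal_set :> set R;
  idealP : is_ideal ideal_set }.

Section QuotientRng.
Variables (R : rngType) (I : ideal R).

Definition ideal_pred : {pred R} := fun x => `[< ideal_set I x >].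

Fact ideal_pred_zmod : zmod_closed ideal_pred.
Proof.
case: (idealP I) => I0 IB _; split; first exact/asboolP.
by move=> x y /asboolP Ix /asboolP Iy; apply/asboolP/IB.
Qed.

HB.instance Definition _ :=
  GRing.isZmodClosed.Build R ideal_pred ideal_pred_zmod.

Definition quot_rng : Type := Quotient.quot ideal_pred.

HB.instance Definition _ := GRing.Zmodule.on quot_rng.
HB.instance Definition _ := Quotient.on quot_rng.

Definition quot_proj (x : R) : quot_rng := \pi_(Quotient.quot ideal_pred) x.

Lemma quot_projE x y : quot_proj x = quot_proj y <-> ideal_set I (x - y).
Proof.
split=> [/eqP|Ixy]; first by rewrite -Quotient.idealrBE => /asboolP.
by apply/eqP; rewrite -Quotient.idealrBE; apply/asboolP.
Qed.

Lemma quot_projB x y : quot_proj (x - y) = quot_proj x - quot_proj y.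
Proof. by rewrite /quot_proj !piE. Qed.

Lemma quot_projD x y : quot_proj (x + y) = quot_proj x + quot_proj y.
Proof. by rewrite /quot_proj !piE. Qed.

Lemma quot_projK (u : quot_rng) : quot_proj (repr u) = u.
Proof. exact: reprK. Qed.

Definition quot_mul (u v : quot_rng) : quot_rng := quot_proj (repr u ** repr v).

Lemma quot_projM x y : quot_proj (x ** y) = quot_mul (quot_proj x) (quot_proj y).
Proof.
rewrite /quot_mul; set x' := repr _; set y' := repr _.
have /quot_projE Ix : quot_proj x = quot_proj x' by rewrite quot_projK.
have /quot_projE Iy : quot_proj y = quot_proj y' by rewrite quot_projK.
case: (idealP I) => I0 IB IM; apply/quot_projE.
have -> : x ** y - x' ** y' = (x - x') ** y - x' ** (- (y - y')).
  rewrite rmulN opprK rmulDl rmulDr rmulN rmulNl.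
  by rewrite addrA addrNK.
by apply: IB; [case: (IM y _ Ix)|rewrite rmulN -rmulNl; case: (IM (- x') _ Iy)].
Qed.

Fact quot_mulA : associative quot_mul.
Proof.
move=> u v w; rewrite -(quot_projK u) -(quot_projK v) -(quot_projK w).
by rewrite -!quot_projM rmulA.
Qed.

Fact quot_mulDl : left_distributive quot_mul +%R.
Proof.
move=> u v w; rewrite -(quot_projK u) -(quot_projK v) -(quot_projK w).
by rewrite -quot_projD -!quot_projM -quot_projD rmulDl.
Qed.

Fact quot_mulDr : right_distributive quot_mul +%R.
Proof.
move=> u v w; rewrite -(quot_projK u) -(quot_projK v) -(quot_projK w).
by rewrite -quot_projD -!quot_projM -quot_projD rmulDr.
Qed.

HB.instance Definition _ :=
  Zmodule_isRng.Build quot_rng quot_mulA quot_mulDl quot_mulDr.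

End QuotientRng.

Section SemiArtinian.

(* A well-ordered type [(A, le)]; its elements stand for the ordinals below
   the order type of [A]. *)
Section Ordinals.
Variables (A : Type) (le : rel A).
Definition ord_lt (a b : A) : Prop := le a b /\ a <> b.
Definition ord_zero (a : A) : Prop := forall b, ~ ord_lt b a.
Definition ord_succ (a b : A) : Prop :=
  ord_lt a b /\ forall c, ~ (ord_lt a c /\ ord_lt c b).
Definition ord_limit (b : A) : Prop :=
  ~ ord_zero b /\ forall a, ~ ord_succ a b.
End Ordinals.

Variable R : rngType.

(* Typing the terms of the chain as two-sided ideals, needed to form the
   quotient ring [R / S a], is no restriction: the socle of a ring is always a
   two-sided ideal. *)
Definition socular_chain (A : Type) (le : rel A) (S : A -> ideal R) : Prop :=
  [/\ forall a, ord_zero le a -> S a = [set 0] :> set R,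
      forall a b, ord_succ le a b ->
        S b = [set x | socle (quot_proj (S a) x)] :> set R &
      forall b, ord_limit le b ->
        S b = \bigcup_(a in [set a | ord_lt le a b]) (S a : set R) :> set R].

Definition semi_artinian : Prop :=
  exists (A : Type) (le : rel A) (S : A -> ideal R),
    [/\ well_order le, socular_chain le S &
        exists lambda, S lambda = [set: R] :> set R].

End SemiArtinian.

Record digraph := Digraph {
  vertex : Type;
  edge : Type;
  esource : edge -> vertex;
  erange : edge -> vertex }.

Section LeavittPathAlgebra.
Variables (E : digraph) (K : fieldType).

Inductive lpa_term : Type :=
| tvertex of vertex E
| tedge of edge E
| tghost of edge E
| tzero
| tadd of lpa_term & lpa_term
| topp of lpa_term
| tscale of K & lpa_term
| tmul of lpa_term & lpa_term.

(* The least congruence containing the axioms of associative, not necessarily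
   unital, K-algebras and the defining relations of the Leavitt path algebra.
   In [lpa_CK2] the list [es] enumerates the edges with source [v] without
   repetition, so that its hypotheses say that [v] is regular. *)
Inductive lpa_eq : lpa_term -> lpa_term -> Prop :=
| lpa_refl x : lpa_eq x x
| lpa_sym x y : lpa_eq x y -> lpa_eq y x
| lpa_trans x y z : lpa_eq x y -> lpa_eq y z -> lpa_eq x z
| lpa_add_congr x x' y y' :
    lpa_eq x x' -> lpa_eq y y' -> lpa_eq (tadd x y) (tadd x' y')
| lpa_opp_congr x x' : lpa_eq x x' -> lpa_eq (topp x) (topp x')
| lpa_scale_congr c x x' : lpa_eq x x' -> lpa_eq (tscale c x) (tscale c x')
| lpa_mul_congr x x' y y' :
    lpa_eq x x' -> lpa_eq y y' -> lpa_eq (tmul x y) (tmul x' y')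
| lpa_addA x y z : lpa_eq (tadd x (tadd y z)) (tadd (tadd x y) z)
| lpa_addC x y : lpa_eq (tadd x y) (tadd y x)
| lpa_add0 x : lpa_eq (tadd tzero x) x
| lpa_addN x : lpa_eq (tadd (topp x) x) tzero
| lpa_scaleA c d x : lpa_eq (tscale c (tscale d x)) (tscale (c * d) x)
| lpa_scale1 x : lpa_eq (tscale 1 x) x
| lpa_scaleDr c x y :
    lpa_eq (tscale c (tadd x y)) (tadd (tscale c x) (tscale c y))
| lpa_scaleDl c d x :
    lpa_eq (tscale (c + d) x) (tadd (tscale c x) (tscale d x))
| lpa_mulA x y z : lpa_eq (tmul x (tmul y z)) (tmul (tmul x y) z)
| lpa_mulDl x y z : lpa_eq (tmul (tadd x y) z) (tadd (tmul x z) (tmul y z))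
| lpa_mulDr x y z : lpa_eq (tmul x (tadd y z)) (tadd (tmul x y) (tmul x z))
| lpa_scaleAl c x y : lpa_eq (tscale c (tmul x y)) (tmul (tscale c x) y)
| lpa_scaleAr c x y : lpa_eq (tscale c (tmul x y)) (tmul x (tscale c y))
| lpa_vertex_idem v : lpa_eq (tmul (tvertex v) (tvertex v)) (tvertex v)
| lpa_vertex_orth v w :
    v <> w -> lpa_eq (tmul (tvertex v) (tvertex w)) tzero
| lpa_source_edge e : lpa_eq (tmul (tvertex (esource e)) (tedge e)) (tedge e)
| lpa_edge_range e : lpa_eq (tmul (tedge e) (tvertex (erange e))) (tedge e)
| lpa_range_ghost e :
    lpa_eq (tmul (tvertex (erange e)) (tghost e)) (tghost e)
| lpa_ghost_source e :
    lpa_eq (tmul (tghost e) (tvertex (esource e))) (tghost e)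
| lpa_CK1_same e : lpa_eq (tmul (tghost e) (tedge e)) (tvertex (erange e))
| lpa_CK1_diff e f : e <> f -> lpa_eq (tmul (tghost e) (tedge f)) tzero
| lpa_CK2 v (es : seq (edge E)) :
    es <> [::] -> List.NoDup es -> (forall e, List.In e es <-> esource e = v) ->
    lpa_eq (tvertex v)
      (foldr (fun e t => tadd (tmul (tedge e) (tghost e)) t) tzero es).

HB.instance Definition _ := gen_eqMixin lpa_term.
HB.instance Definition _ := gen_choiceMixin lpa_term.

Definition lpa_rel : rel lpa_term := fun x y => `[< lpa_eq x y >].

Fact lpa_rel_equiv : equiv_class_of lpa_rel.
Proof.
split=> [x|x y|y x z]; first by apply/asboolP/lpa_refl.
  by apply/asboolP/asboolP; exact: lpa_sym.
by move=> /asboolP h1 /asboolP h2; apply/asboolP/(lpa_trans h1 h2).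
Qed.

Canonical lpa_equiv := EquivRelPack lpa_rel_equiv.

Definition lpa : Type := {eq_quot lpa_rel}.

HB.instance Definition _ := Choice.on lpa.

Definition lpa_class (x : lpa_term) : lpa := \pi_({eq_quot lpa_rel}) x.

Lemma lpa_classE x y : lpa_class x = lpa_class y <-> lpa_eq x y.
Proof. by split=> [/eqmodP/asboolP|h]; last apply/eqmodP/asboolP. Qed.

Lemma lpa_reprK (u : lpa) : lpa_class (repr u) = u.
Proof. exact: reprK. Qed.

Lemma lpa_repr_class x : lpa_eq (repr (lpa_class x)) x.
Proof. by apply/lpa_classE; rewrite lpa_reprK. Qed.

Lemma lpa_ind (P : lpa -> Prop) : (forall x, P (lpa_class x)) -> forall u, P u.
Proof. by move=> Pc u; rewrite -(lpa_reprK u). Qed.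

Definition lpa_zero : lpa := lpa_class tzero.
Definition lpa_add (u v : lpa) : lpa := lpa_class (tadd (repr u) (repr v)).
Definition lpa_opp (u : lpa) : lpa := lpa_class (topp (repr u)).
Definition lpa_scale (c : K) (u : lpa) : lpa := lpa_class (tscale c (repr u)).
Definition lpa_mul (u v : lpa) : lpa := lpa_class (tmul (repr u) (repr v)).

Lemma lpa_addE x y :
  lpa_add (lpa_class x) (lpa_class y) = lpa_class (tadd x y).
Proof. by apply/lpa_classE/lpa_add_congr; exact: lpa_repr_class. Qed.

Lemma lpa_oppE x : lpa_opp (lpa_class x) = lpa_class (topp x).
Proof. by apply/lpa_classE/lpa_opp_congr; exact: lpa_repr_class. Qed.

Lemma lpa_scaleE c x : lpa_scale c (lpa_class x) = lpa_class (tscale c x).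
Proof. by apply/lpa_classE/lpa_scale_congr; exact: lpa_repr_class. Qed.

Lemma lpa_mulE x y :
  lpa_mul (lpa_class x) (lpa_class y) = lpa_class (tmul x y).
Proof. by apply/lpa_classE/lpa_mul_congr; exact: lpa_repr_class. Qed.

Let lpaE := (lpa_addE, lpa_oppE, lpa_scaleE, lpa_mulE).

Fact lpa_add_assoc : associative lpa_add.
Proof.
elim/lpa_ind=> x; elim/lpa_ind=> y; elim/lpa_ind=> z.
by rewrite !lpaE; apply/lpa_classE/lpa_addA.
Qed.

Fact lpa_add_comm : commutative lpa_add.
Proof.
elim/lpa_ind=> x; elim/lpa_ind=> y.
by rewrite !lpaE; apply/lpa_classE/lpa_addC.
Qed.

Fact lpa_add0r : left_id lpa_zero lpa_add.
Proof. by elim/lpa_ind=> x; rewrite !lpaE; apply/lpa_classE/lpa_add0. Qed.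

Fact lpa_addNr : left_inverse lpa_zero lpa_opp lpa_add.
Proof. by elim/lpa_ind=> x; rewrite !lpaE; apply/lpa_classE/lpa_addN. Qed.

HB.instance Definition _ := GRing.isZmodule.Build lpa
  lpa_add_assoc lpa_add_comm lpa_add0r lpa_addNr.

Fact lpa_mul_assoc : associative lpa_mul.
Proof.
elim/lpa_ind=> x; elim/lpa_ind=> y; elim/lpa_ind=> z.
by rewrite !lpaE; apply/lpa_classE/lpa_mulA.
Qed.

Fact lpa_mul_addl : left_distributive lpa_mul +%R.
Proof.
elim/lpa_ind=> x; elim/lpa_ind=> y; elim/lpa_ind=> z.
by rewrite /GRing.add /= !lpaE; apply/lpa_classE/lpa_mulDl.
Qed.

Fact lpa_mul_addr : right_distributive lpa_mul +%R.
Proof.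
elim/lpa_ind=> x; elim/lpa_ind=> y; elim/lpa_ind=> z.
by rewrite /GRing.add /= !lpaE; apply/lpa_classE/lpa_mulDr.
Qed.

HB.instance Definition _ := Zmodule_isRng.Build lpa
  lpa_mul_assoc lpa_mul_addl lpa_mul_addr.

Fact lpa_scale_assoc c d (u : lpa) :
  lpa_scale c (lpa_scale d u) = lpa_scale (c * d) u.
Proof.
by elim/lpa_ind: u => x; rewrite !lpaE; apply/lpa_classE/lpa_scaleA.
Qed.

Fact lpa_scale_1l : left_id 1 lpa_scale.
Proof. by elim/lpa_ind=> x; rewrite !lpaE; apply/lpa_classE/lpa_scale1. Qed.

Fact lpa_scale_addr : right_distributive lpa_scale +%R.
Proof.
move=> c; elim/lpa_ind=> x; elim/lpa_ind=> y.
by rewrite /GRing.add /= !lpaE; apply/lpa_classE/lpa_scaleDr.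
Qed.

Fact lpa_scale_addl (u : lpa) : {morph lpa_scale^~ u : c d / c + d}.
Proof.
elim/lpa_ind: u => x c d.
by rewrite [RHS]/GRing.add /= !lpaE; apply/lpa_classE/lpa_scaleDl.
Qed.

HB.instance Definition _ := GRing.Zmodule_isLmodule.Build K lpa
  lpa_scale_assoc lpa_scale_1l lpa_scale_addr lpa_scale_addl.

Lemma lpa_scalerAl (c : K) (u v : lpa) : c *: (u ** v) = (c *: u) ** v.
Proof.
elim/lpa_ind: u => x; elim/lpa_ind: v => y.
by rewrite /GRing.scale /rmul /= !lpaE; apply/lpa_classE/lpa_scaleAl.
Qed.

Lemma lpa_scalerAr (c : K) (u v : lpa) : c *: (u ** v) = u ** (c *: v).
Proof.
elim/lpa_ind: u => x; elim/lpa_ind: v => y.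
by rewrite /GRing.scale /rmul /= !lpaE; apply/lpa_classE/lpa_scaleAr.
Qed.

End LeavittPathAlgebra.

(* Main.v *)
(** Simple modules are the quotients by modular maximal left ideals. In an acyclic
    graph every element outside a two-sided ideal I can be multiplied on both sides
    into u - sum_(e in A) e e^*, modulo I and still outside I, where A is a finite
    set of edges leaving u. So every ideal is an intersection of primitive ideals,
    and finitely many simple modules leave room for finitely many ideals only.
    Moreover L/I has a minimal left ideal unless every vertex outside I leads to one
    with two edges to vertices outside I.

    Both obstructions, closed paths and branching, yield infinitely many
    Chen modules. For a closed path c these are twists by the roots of irreducible
    polynomials over K. Branching produces uncountably many infinite paths, whose
    tail classes are countable on the binary tree.

    Conversely, over a semi-artinian ring a simple module is determined by its
    annihilator: it is isomorphic to any simple left ideal of L/S_alpha not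
    annihilating it, for the least alpha such that S_(alpha+1) does not annihilate it. *)

Require Import Defs.
From HB Require Import structures.
From mathcomp Require Import all_boot all_order all_algebra all_field.
From mathcomp Require Import generic_quotient ring_quotient.
From mathcomp Require Import wochoice all_classical.

Set Implicit Arguments.
Unset Strict Implicit.
Unset Printing Implicit Defensive.

Import GRing.Theory.
Local Open Scope classical_set_scope.
Local Open Scope quotient_scope.
Local Open Scope ring_scope.

(** * Modular maximal left ideals *)

(** The algebra need not have a unit, so a simple module is presented as L/N with N a left ideal
    that has a right unit modulo N, and an isomorphism between L/N and L/N' is remembered only as an
    element b with N = { a | a b in N' }. Chen modules are therefore never built as modules: the
    annihilator of one infinite path stands for each, and telling two of them apart means studying a
    single element b.

    Three obstacles shape the rest. A vertex may emit infinitely many edges, where (CK2) says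
    nothing; the elements u - sum e e^* measure what is missing, and for an empty sum they give back
    the vertex. The field may be finite, so that scalars of K alone give too few twists of a closed
    path; the twisting scalars come from extension fields of K, while the algebra keeps its scalars
    in K. Finally, acyclicity has to be established before the ideals are counted, because it is
    what makes distinct paths with a common end orthogonal. *)

Section QuotientModule.
Variables (R : rngType) (N : set (regular_mod R)) (hN : is_submodule N).

(* The proof that [N] is a submodule is kept as a phantom argument, so that the
   structure instances on the quotient can be inferred from its type. *)
Definition submod_pred of is_submodule N : {pred R} := fun x => `[< N x >].

Fact submod_pred_zmod : zmod_closed (submod_pred hN).
Proof.
have [N0 NB _] := hN; split; first exact/asboolP.
by move=> x y /asboolP Ix /asboolP Iy; apply/asboolP/NB.
Qed.

HB.instance Definition _ :=
  GRing.isZmodClosed.Build R (submod_pred hN) submod_pred_zmod.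

Definition quot_mod : Type := Quotient.quot (submod_pred hN).

HB.instance Definition _ := GRing.Zmodule.on quot_mod.
HB.instance Definition _ := Quotient.on quot_mod.

Definition mod_proj (x : R) : quot_mod := \pi_(Quotient.quot (submod_pred hN)) x.

Lemma mod_projE x y : mod_proj x = mod_proj y <-> N (x - y).
Proof.
split=> [/eqP|Nxy]; first by rewrite -Quotient.idealrBE => /asboolP.
by apply/eqP; rewrite -Quotient.idealrBE; apply/asboolP.
Qed.

Lemma mod_projD x y : mod_proj (x + y) = mod_proj x + mod_proj y.
Proof. by rewrite /mod_proj !piE. Qed.

Lemma mod_projB x y : mod_proj (x - y) = mod_proj x - mod_proj y.
Proof. by rewrite /mod_proj !piE. Qed.

Lemma mod_projK (u : quot_mod) : mod_proj (repr u) = u.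
Proof. exact: reprK. Qed.

Lemma mod_proj_surj (u : quot_mod) : exists x, u = mod_proj x.
Proof. by exists (repr u); rewrite mod_projK. Qed.

Lemma mod_proj_eq0 x : mod_proj x = 0 <-> N x.
Proof.
have -> : 0 = mod_proj 0 by rewrite -[X in mod_proj X](subrr 0) mod_projB subrr.
by rewrite mod_projE subr0.
Qed.

Definition quot_act (a : R) (u : quot_mod) : quot_mod := mod_proj (a ** repr u).

Lemma quot_actE a x : quot_act a (mod_proj x) = mod_proj (a ** x).
Proof.
apply/mod_projE; have [_ _ NM] := hN.
by rewrite -rmulN -rmulDr; apply: NM; apply/mod_projE; rewrite mod_projK.
Qed.

Fact quot_actA a b u : quot_act a (quot_act b u) = quot_act (a ** b) u.
Proof. by rewrite -(mod_projK u) !quot_actE rmulA. Qed.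

Fact quot_actDl u : {morph quot_act^~ u : a b / a + b}.
Proof.
by move=> a b; rewrite -(mod_projK u) !quot_actE rmulDl mod_projD.
Qed.

Fact quot_actDr a : {morph quot_act a : u v / u + v}.
Proof.
move=> u v; rewrite -(mod_projK u) -(mod_projK v) -mod_projD !quot_actE.
by rewrite rmulDr mod_projD.
Qed.

HB.instance Definition _ :=
  Zmodule_isRngModule.Build R quot_mod quot_actA quot_actDl quot_actDr.

Lemma ract_projE a x : ract a (mod_proj x) = mod_proj (a ** x).
Proof. exact: quot_actE. Qed.

End QuotientModule.

Lemma subrACA (V : zmodType) (x y z t : V) : x - y - (z - t) = x - z - (y - t).
Proof. by rewrite !opprB addrACA [RHS]addrACA (addrC (- y)). Qed.

Section ModularMaximal.
Variable R : rngType.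
Implicit Types (N : set (regular_mod R)) (M : rngModType R).

Lemma ractB M (a : R) (x y : M) : ract a (x - y) = ract a x - ract a y.
Proof. by apply/eqP; rewrite -subr_eq opprK -ractDr subrK. Qed.

Lemma ract0 M (a : R) : ract a (0 : M) = 0.
Proof. by rewrite -[X in ract _ X](subrr 0) ractB subrr. Qed.

Lemma ractBl M (a b : R) (x : M) : ract (a - b) x = ract a x - ract b x.
Proof. by apply/eqP; rewrite -subr_eq opprK -ractDl subrK. Qed.

Lemma ract0l M (x : M) : ract 0 x = 0.
Proof. by rewrite -[X in ract X _](subrr 0) ractBl subrr. Qed.

Lemma rmulBr (x y z : R) : x ** (y - z) = x ** y - x ** z.
Proof. by rewrite rmulDr rmulN. Qed.

Lemma rmulBl (x y z : R) : (y - z) ** x = y ** x - z ** x.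
Proof. by rewrite rmulDl rmulNl. Qed.

Lemma submod0 M (N : set M) : is_submodule N -> N 0.
Proof. by case. Qed.

Lemma submodB M (N : set M) : is_submodule N -> forall x y, N x -> N y -> N (x - y).
Proof. by case. Qed.

Lemma submodN M (N : set M) : is_submodule N -> forall x, N x -> N (- x).
Proof. by move=> h x Nx; rewrite -sub0r; apply: (submodB h) => //; exact: submod0. Qed.

Lemma submodD M (N : set M) : is_submodule N -> forall x y, N x -> N y -> N (x + y).
Proof. by move=> h x y Nx Ny; rewrite -[y]opprK; apply: submodB => //; exact: submodN. Qed.

Lemma submodM M (N : set M) : is_submodule N -> forall a x, N x -> N (ract a x).
Proof. by case. Qed.

Lemma submod_subl M (N : set M) : is_submodule N ->
  forall x y, N (x - y) -> N y -> N x.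
Proof. by move=> h x y hxy hy; rewrite -(subrK y x); apply: submodD. Qed.

Lemma submod_trans M (N : set M) : is_submodule N ->
  forall y x z, N (x - y) -> N (y - z) -> N (x - z).
Proof. by move=> h y x z hxy /(submodD h hxy); rewrite addrA subrK. Qed.

(* In the absence of a unit, these are the annihilators of the nonzero elements of
   the simple modules; [u] is a right unit modulo [N]. *)
Definition modular_maximal N : Prop :=
  [/\ is_submodule N,
      exists u : R, ~ N u /\ forall a : R, N (a - a ** u) &
      forall N', is_submodule N' -> N `<=` N' -> N' = N \/ N' = setT].

Lemma quot_mod_simple N (hN : is_submodule N) :
  modular_maximal N -> simple_module (quot_mod hN).
Proof.
case=> _ [u [Nu Nau]] maxN; split.
- by split=> //.
- exists u, (mod_proj hN u); split=> //.
  rewrite ract_projE => /mod_proj_eq0 Nuu; apply: Nu.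
  exact: (submod_subl hN (Nau u)).
- move=> P hP _; pose P' : set (regular_mod R) := [set x | P (mod_proj hN x)].
  have hP' : is_submodule P'.
    split=> [|x y|a x]; rewrite /P' /=.
    + by rewrite (mod_proj_eq0 hN 0).2; [exact: (submod0 hP)|exact: (submod0 hN)].
    + by move=> Px Py; rewrite mod_projB; exact: submodB.
    + by move=> Px; have := submodM hP a Px; rewrite ract_projE.
  have NP' : N `<=` P'.
    by move=> x Nx; rewrite /P' /= (mod_proj_eq0 hN x).2 //; exact: (submod0 hP).
  have [eP|eP] := maxN _ hP' NP'; [left|right]; apply/seteqP; split=> x.
  + have [y ->] := mod_proj_surj x => Py; apply/mod_proj_eq0.
    by have : P' y by []; rewrite eP.
  + by move=> ->; exact: (submod0 hP).
  + by [].
  + by move=> _; have [y ->] := mod_proj_surj x; have : P' y by rewrite eP.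
Qed.

(** Since [a ** u] equals [a] modulo [N], the left ideal [N] is the annihilator of the class of [u].
    An isomorphism carries this class to that of some [b], with annihilator { a | a b in N' }. *)
Lemma quot_mod_iso N N' (hN : is_submodule N) (hN' : is_submodule N') :
  modular_maximal N -> module_iso (quot_mod hN) (quot_mod hN') ->
  exists b : R, forall a : R, N a <-> N' (a ** b).
Proof.
case=> _ [u [Nu Nau]] maxN [f [bij_f fM]].
exists (repr (f (mod_proj hN u))) => a.
rewrite -(mod_proj_eq0 hN) -(mod_proj_eq0 hN') -ract_projE mod_projK -fM.
have <- : mod_proj hN a = ract a (mod_proj hN u).
  by rewrite ract_projE; apply/mod_projE.
split=> h; first by rewrite h raddf0.
by apply: (bij_inj bij_f); rewrite h raddf0.
Qed.

Lemma module_iso_sym M M' : module_iso M M' -> module_iso M' M.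
Proof.
case=> f [[g fK gK] fM].
have gD : {morph g : x y / x - y}.
  by move=> x y; apply: (can_inj fK); rewrite raddfB !gK.
pose gadd : {additive M' -> M} :=
  HB.pack g (GRing.isZmodMorphism.Build _ _ g gD).
exists gadd; split; first by exists f.
by move=> a x; apply: (can_inj fK); rewrite fM !gK.
Qed.

Lemma module_iso_trans M1 M2 M3 :
  module_iso M1 M2 -> module_iso M2 M3 -> module_iso M1 M3.
Proof.
case=> f [bf fM] [g [bg gM]]; exists (g \o f); split.
  exact: bij_comp.
by move=> a x /=; rewrite fM gM.
Qed.

(** The passage from (i) to (ii) uses finiteness only in this form, which speaks of left ideals
    alone. [cl N i] labels [N] by a listed module isomorphic to its quotient. *)
Lemma finitely_many_classes : finitely_many_simple_left_modules R ->
  exists (n : nat) (cl : set (regular_mod R) -> 'I_n -> Prop),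
    (forall N, modular_maximal N -> exists i, cl N i) /\
    forall N N' i, modular_maximal N -> modular_maximal N' -> cl N i -> cl N' i ->
      exists b : R, forall a : R, N a <-> N' (a ** b).
Proof.
case=> n [S [_ hS]].
exists n, (fun N i => exists hN : is_submodule N, module_iso (quot_mod hN) (S i)).
split=> [N mN|N N' i mN mN' [hN iN] [hN' iN']].
  have [hN _ _] := mN; have [i hi] := hS _ (quot_mod_simple hN mN).
  by exists i, hN.
apply: quot_mod_iso mN _.
exact: (module_iso_trans iN (module_iso_sym iN')).
Qed.

(** As [e] is a right unit modulo [N0], a left ideal containing [N0] and [e] is the whole ring.
    Hence one that is maximal among those above [N0] avoiding [e] is maximal outright. *)
Lemma modular_maximal_exists (N0 : set (regular_mod R)) (e : R) :
  is_submodule N0 -> ~ N0 e -> (forall a : R, N0 (a - a ** e)) ->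
  exists N, [/\ modular_maximal N, N0 `<=` N & ~ N e].
Proof.
move=> hN0 N0e N0m.
pose good (A : set (regular_mod R)) := [/\ is_submodule A, N0 `<=` A & ~ A e].
have [F Fgood Ftot|N [gN maxN]] := @Zorn_bigcup (regular_mod R)
    [set A | A = set0 \/ good A].
  have [[A [FA A0]]|nF] := pselect (exists A, F A /\ A !=set0); last first.
    left; apply/seteqP; split=> x // [A FA Ax]; apply: nF.
    by exists A; split=> //; exists x.
  right; have [A0'|gA] := Fgood _ FA.
    by case: A0 => x; rewrite A0'.
  have Fg B x : F B -> B x -> good B.
    by move=> FB Bx; case: (Fgood _ FB) => // B0; rewrite B0 in Bx.
  split=> [|x N0x|[B FB Be]]; last 2 first.
  - by exists A => //; case: gA => _ + _; apply.
  - by case: (Fg _ _ FB Be).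
  split=> [|x y [B FB Bx] [C FC Cy]|a x [B FB Bx]].
  - by exists A => //; case: gA => /submod0.
  - have [BC|CB] := Ftot _ _ FB FC.
      exists C => //; have [hC _ _] := Fg _ _ FC Cy.
      by apply: submodB => //; exact: BC.
    exists B => //; have [hB _ _] := Fg _ _ FB Bx.
    by apply: submodB => //; exact: CB.
  - by exists B => //; have [hB _ _] := Fg _ _ FB Bx; exact: submodM.
have {}gN : good N.
  case: gN => // N0'; exfalso; apply: (maxN N0); last by right; split.
  rewrite N0'; split => // /(_ 0); apply; exact: submod0.
have [hN N0N Ne] := gN; exists N; split=> //; split=> //.
  by exists e; split=> // a; apply: N0N.
move=> N' hN' NN'.
have [N'e|N'e] := pselect (N' e).
  right; apply/seteqP; split=> // a _.
  apply: (submod_subl hN' (y := a ** e)); first by apply/NN'/N0N.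
  exact: (submodM hN' a N'e).
left; apply: contrapT => N'N; apply: (maxN N').
  split => // N'N2; apply: N'N; exact/seteqP.
by right; split=> // x /N0N /NN'.
Qed.

End ModularMaximal.

Lemma ideal_submod (R : rngType) (I : set R) : is_ideal I ->
  @is_submodule R (regular_mod R) I.
Proof. by case=> I0 IB IM; split=> // a x Ix; case: (IM a x Ix). Qed.

(** * Finiteness of the set of two-sided ideals *)

Section FiniteIdeals.
Variable R : rngType.

(* The hypothesis makes every ideal an intersection of primitive ideals, so that it
   is determined by the classes of modular maximal left ideals containing it. *)
Lemma finite_ideals : finitely_many_simple_left_modules R ->
  (forall (I : set R) x, is_ideal I -> ~ I x ->
     exists y z e, [/\ ~ I e, I (y ** x ** z - e) & I (e ** e - e)]) ->
  finite_set [set I : set R | is_ideal I].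
Proof.
move=> /finitely_many_classes[n [cl [clN clI]]] red.
have sep I x : is_ideal I -> ~ I x -> exists N a,
    [/\ @modular_maximal R N, I `<=` N & ~ N (x ** a)].
  move=> idI Ix; have [y [z [e [Ie Iyxz Iee]]]] := red I x idI Ix.
  have hI := ideal_submod idI.
  (* This is I + R(1 - e), with [e] as right unit. It misses [e]: multiplying e = a - a e on the
     right by the idempotent [e] would give e = 0 modulo [I]. *)
  pose N0 : set (regular_mod R) := [set b | exists a : R, I (b - (a - a ** e))].
  have hN0 : is_submodule N0.
    split=> [|b c [a1 h1] [a2 h2]|c b [a h]].
    - by exists 0; rewrite rmul0l !subr0; exact: (submod0 hI).
    - exists (a1 - a2); have := submodB hI h1 h2.
      by rewrite !rmulBl subrACA [in _ - (a2 - _)]subrACA.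
    - exists (c ** a); have := submodM hI c h.
      by rewrite /ract /= /regular_act !rmulBr rmulA.
  have [| |N [mN N0N Ne]] := modular_maximal_exists (e := e) hN0.
  - move=> [a h]; apply: Ie.
    have [_ _ IM] := idI; have [_ h2] := IM e _ h.
    have := submodB hI (submodB hI h2 Iee) (IM a _ Iee).1.
    rewrite !rmulBl !rmulBr !rmulA.
    by rewrite -[a ** e - _]opprB opprK addrAC addrK subKr.
  - by move=> a; exists a; rewrite subrr; exact: (submod0 hI).
  have IN : I `<=` N.
    by move=> b Ib; apply: N0N; exists 0; rewrite rmul0l !subr0.
  exists N, z; split=> // Nxz; apply: Ne; have [hN _ _] := mN.
  have := submodB hN (submodM hN y Nxz) (IN _ Iyxz).
  by rewrite /ract /= /regular_act rmulA opprB addrC subrK.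
pose f (I : set R) : {ffun 'I_n -> bool} :=
  [ffun i => `[< exists N, [/\ modular_maximal N, cl N i & I `<=` N] >]].
have finj : {in [set I | is_ideal I] &, injective f}.
  suff h I J : is_ideal I -> is_ideal J -> f I = f J -> I `<=` J.
    move=> I J /set_mem idI /set_mem idJ e.
    by apply/seteqP; split; apply: h.
  move=> idI idJ e x Ix; apply: contrapT => Jx.
  have [N [a [mN JN Nxa]]] := sep J x idJ Jx.
  have [i ci] := clN _ mN.
  have : f J i by rewrite ffunE; apply/asboolP; exists N.
  rewrite -e ffunE => /asboolP[N' [mN' ci' IN']].
  (* [N] consists of the [c] with [c ** b] in [N']. As [I] is two-sided, [x ** a ** b] lies in [I]
     and so in [N'], which puts [x ** a] in [N]. *)
  have [b Nb] := clI _ _ _ mN mN' ci ci'.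
  apply/Nxa/Nb/IN'; case: idI => _ _ IM.
  by have [_ h1] := IM a _ Ix; have [_] := IM b _ h1.
have : finite_set (f @` [set I | is_ideal I]) by exact: finite_finset.
by rewrite (eq_finite_set (inj_card_eq finj)).
Qed.

End FiniteIdeals.

(** * Socles and semi-artinian rings *)

Section Socle.
Variable R : rngType.

Definition in_simple (y : R) : Prop :=
  exists I : set (regular_mod R), simple_submodule I /\ I y.

Lemma in_simple_map (f : R -> R) x : f 0 = 0 -> {morph f : x y / x + y} ->
  (forall y, in_simple y -> in_simple (f y)) -> socle x -> socle (f x).
Proof.
move=> f0 fD fS [n [y [hy ->]]]; exists n, (f \o y); split=> [i|].
  by apply: fS; exact: hy.
by rewrite (big_morph f fD f0).
Qed.

Lemma socleD (x y : R) : socle x -> socle y -> socle (x + y).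
Proof.
move=> [m [a [ha ->]]] [n [b [hb ->]]].
exists (m + n)%N, (fun i => match fintype.split i with inl j => a j | inr j => b j end).
split=> [i|]; first by case: (fintype.split i).
rewrite big_split_ord /=; congr (_ + _); apply: eq_bigr => i _.
  by rewrite (unsplitK (inl i)).
by rewrite (unsplitK (inr i)).
Qed.

(** Right multiplication by [r] is a homomorphism of left modules; being nonzero on the simple [I],
    it is injective there, so the image is simple. This makes the socle a right ideal too. *)
Lemma simple_mulr (I : set (regular_mod R)) (r : R) : simple_submodule I ->
  (exists2 y : R, I y & y ** r <> 0) ->
  simple_submodule ([set z : regular_mod R | exists2 y : R, I y & z = y ** r]).
Proof.
move=> [hI [a0 [x0 [Ix0 ax0]]] minI] [y Iy yr].
have kerI (x : R) : I x -> x ** r = 0 -> x = 0.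
  move=> Ix xr; pose Q : set (regular_mod R) := [set z : R | I z /\ z ** r = 0].
  have hQ : is_submodule Q.
    split=> [|u v [Iu ur] [Iv vr]|a u [Iu ur]].
    - by split; [exact: (submod0 hI)|rewrite rmul0l].
    - by split; [exact: (submodB hI)|rewrite rmulBl ur vr subrr].
    - split; first exact: (submodM hI).
      by rewrite /ract /= /regular_act -rmulA ur rmul0.
  have [e|e] := minI Q hQ (fun z h => h.1).
    by have : Q x by []; rewrite e.
  have : Q y by rewrite e.
  by case=> _ /yr.
split.
- split=> [|u v [u' Iu ->] [v' Iv ->]|a u [u' Iu ->]].
  + by exists 0; [exact: (submod0 hI)|rewrite rmul0l].
  + by exists (u' - v'); [exact: (submodB hI)|rewrite rmulBl].
  + by exists (a ** u'); [exact: (submodM hI)|rewrite /ract /= /regular_act rmulA].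
- exists a0, ((x0 : R) ** r); split; first by exists x0.
  rewrite /ract /= /regular_act rmulA => h; apply: ax0.
  by apply: kerI => //; exact: (submodM hI).
- move=> N' hN' N'I; pose Q : set (regular_mod R) := [set z : R | I z /\ N' (z ** r)].
  have hQ : is_submodule Q.
    split=> [|u v [Iu ur] [Iv vr]|a u [Iu ur]].
    - by split; [exact: (submod0 hI)|rewrite rmul0l; exact: (submod0 hN')].
    - by split; [exact: (submodB hI)|rewrite rmulBl; exact: (submodB hN')].
    - split; first exact: (submodM hI).
      by rewrite /ract /= /regular_act -rmulA; exact: (submodM hN').
  have [e|e] := minI Q hQ (fun z h => h.1); [left|right]; apply/seteqP; split.
  + move=> z N'z; have [z' Iz' ez] := N'I _ N'z.
    have : Q z' by split=> //; rewrite -ez.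
    by rewrite e ez => ->; rewrite rmul0l.
  + by move=> z ->; exact: (submod0 hN').
  + by [].
  + move=> _ [z Iz ->]; have : Q z by rewrite e.
    by case.
Qed.

Lemma socle_ideal : is_ideal (@socle R).
Proof.
have soc0 : socle (0 : R).
  by exists 0%N, (fun=> 0); split=> [[]//|]; rewrite big_ord0.
split=> [//|x y sx sy|a x sx].
  apply: socleD => //; apply: (in_simple_map (f := -%R)) => //.
  - exact: oppr0.
  - exact: opprD.
  - by move=> z [I [sI Iz]]; exists I; split=> //; case: sI => hI _ _; exact: (submodN hI).
split.
- apply: (in_simple_map (f := fun z => a ** z)) => //.
  + exact: rmul0.
  + exact: rmulDr.
  + by move=> z [I [sI Iz]]; exists I; split=> //; case: sI => hI _ _; exact: (submodM hI).
- apply: (in_simple_map (f := fun z => z ** a)) => //.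
  + exact: rmul0l.
  + by move=> z t; exact: rmulDl.
  + move=> z [I [sI Iz]]; have [za|za] := pselect (z ** a = 0).
      by exists I; split=> //; rewrite za; case: sI => hI _ _; exact: (submod0 hI).
    exists [set t : regular_mod R | exists2 y : R, I y & t = y ** a].
    by split; [apply: simple_mulr => //; exists z|exists z].
Qed.

End Socle.

Section Chain.
Variable R : rngType.

Lemma quot_proj0 (I : ideal R) : quot_proj I 0 = 0.
Proof. by rewrite -[X in quot_proj I X](subrr 0) quot_projB subrr. Qed.

Lemma quot_proj_rmul (I : ideal R) x y :
  quot_proj I (x ** y) = quot_proj I x ** quot_proj I y.
Proof. exact: quot_projM. Qed.

Lemma quot_proj_eq0 (I : ideal R) x : quot_proj I x = 0 <-> ideal_set I x.
Proof. by rewrite -(quot_proj0 I) quot_projE subr0. Qed.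

Lemma socle_preim_ideal (I : ideal R) : is_ideal [set x | socle (quot_proj I x)].
Proof.
have [s0 sB sM] := socle_ideal (quot_rng I).
split=> [|x y /= sx sy|a x /= sx].
- by rewrite /= quot_proj0.
- by rewrite quot_projB; exact: sB.
- by rewrite !quot_projM; exact: sM.
Qed.

Lemma zero_ideal : is_ideal [set (0 : R)].
Proof.
split=> [//|x y -> ->|a x ->]; first by rewrite subr0.
by rewrite rmul0 rmul0l.
Qed.

(** Finite stages will be enough, so the chain is indexed by [nat], where the limit clause of
    [socular_chain] is vacuous. *)
Fixpoint socle_chain (n : nat) : ideal R :=
  if n is m.+1 then Ideal (socle_preim_ideal (socle_chain m))
  else Ideal zero_ideal.

Lemma leq_well_order : well_order leq.
Proof.
move=> A [x Ax]; case: (ex_minnP (ex_intro A x Ax)) => m Am minm.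
exists m; split=> [|z [Az zmin]]; first by split=> // z Az; exact: minm.
by apply/eqP; rewrite eqn_leq minm //= zmin.
Qed.

Lemma socular_chain_nat : socular_chain leq socle_chain.
Proof.
have ltE a b : ord_lt leq a b <-> (a < b)%N.
  rewrite /ord_lt ltn_neqAle; split=> [[-> /eqP->]|/andP[/eqP ab ->]] //.
split=> [a a0|a b [ab nc]|b [nb0 nb]].
- case: a a0 => // a a0; exfalso; apply: (a0 0%N); exact/ltE.
- have -> : b = a.+1; last by [].
  move/ltE: ab => ab; apply/eqP; rewrite eqn_leq ab andbT leqNgt; apply/negP => h.
  by apply: (nc a.+1); split; apply/ltE.
- exfalso; case: b nb0 nb => [nb0 _|b _ nb].
    by apply: nb0 => b /ltE.
  apply: (nb b); split; first exact/ltE.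
  by move=> c [/ltE bc /ltE]; rewrite ltnS leqNgt bc.
Qed.

(** A chain that never reached the ring would grow strictly at each step and yield infinitely many
    ideals. *)
Lemma semi_artinian_of_finite_ideals :
  finite_set [set I : set R | is_ideal I] ->
  (forall I : ideal R, I <> setT :> set R ->
     exists2 x, ~ ideal_set I x & socle (quot_proj I x)) ->
  semi_artinian R.
Proof.
move=> fin hsoc; exists nat, leq, socle_chain; split.
- exact: leq_well_order.
- exact: socular_chain_nat.
apply: contrapT => nT.
have sub n : socle_chain n `<=` socle_chain n.+1.
  move=> x Ix /=; rewrite (quot_proj_eq0 _ x).2 //; exact: submod0 (ideal_submod (socle_ideal _)).
have mono m n : (m <= n)%N -> socle_chain m `<=` socle_chain n.
  by move/subnK <-; elim: (n - m)%N => // k IH x /IH /sub.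
have inj : injective (fun n => socle_chain n : set R).
  suff lt m n : (m < n)%N -> socle_chain m <> socle_chain n :> set R.
    move=> m n e; case: (ltngtP m n) => // h; first by case: (lt _ _ h).
    by case: (lt _ _ h).
  move=> mn e; have [x nx sx] : exists2 x, ~ ideal_set (socle_chain m) x & ideal_set (socle_chain m.+1) x.
    by apply: hsoc => eT; apply: nT; exists m.
  by apply: nx; rewrite e; apply: mono sx.
apply: infinite_nat; rewrite -(eq_finite_set (inj_card_eq (in2W inj))).
by apply: sub_finite_set fin => _ [n _ <-]; exact: idealP.
Qed.

End Chain.

(** * Simple modules over a semi-artinian ring *)

Section Annihilator.
Variable R : rngType.
Implicit Types M N : rngModType R.

Definition ann M : set R := [set a | forall x : M, ract a x = 0].

Lemma ann_ideal M : is_ideal (ann M).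
Proof.
split=> [x|a b ha hb x|a b hb]; first exact: ract0l.
  by rewrite ractBl ha hb subr0.
split=> x; first by rewrite -ractA hb ract0.
by rewrite -ractA hb.
Qed.

Lemma ract_sum M n (F : 'I_n -> R) (x : M) :
  ract (\sum_(i < n) F i) x = \sum_(i < n) ract (F i) x.
Proof. by apply: (big_morph (fun a => ract a x)); [move=> a b; exact: ractDl|exact: ract0l]. Qed.

Lemma semi_artinian_socle M : semi_artinian R -> simple_module M ->
  exists (J : ideal R) (I : set (regular_mod (quot_rng J))) (y : R),
    [/\ J `<=` ann M, simple_submodule I, I (quot_proj J y) & ~ ann M y].
Proof.
move=> [A [le [S [wo [S0 Ssucc Slim] [l Sl]]]]] [_ [a0 [x0 [_ ax0]]] _].
pose B : pred A := fun a => `[< ~ (S a `<=` ann M) >].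
have [|z [[/asboolP Bz zmin] _]] := wo B.
  exists l; apply/asboolP => h; apply: ax0.
  by have : ann M a0 by apply: h; rewrite Sl.
have below a : ord_lt le a z -> S a `<=` ann M.
  move=> [az ne]; apply: contrapT => h.
  have Ba : a \in B by exact/asboolP.
  have za := zmin _ Ba; apply: ne.
  (* Reflexivity and antisymmetry of [le] are extracted from [well_order] by applying it to a
     singleton and to the pair of [a] and [z]. *)
  have refl b : le b b.
    have [|w [[/asboolP -> bmin] _]] := wo (fun c => `[< c = b >]).
      by exists b; exact/asboolP.
    by apply: bmin; exact/asboolP.
  have [|w [_ wuniq]] := wo (fun c => `[< c = a \/ c = z >]).
    by exists a; apply/asboolP; left.
  transitivity w; first (symmetry; apply: wuniq; split).
  - by apply/asboolP; left.
  - by move=> c /asboolP[->|->].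
  - apply: wuniq; split; first by apply/asboolP; right.
    by move=> c /asboolP[->|->].
(* The zero ideal and a union of ideals killing [M] both kill [M], so the least index [z] that does
   not is a successor. *)
have z0 : ~ ord_zero le z.
  by move=> /S0 e; apply: Bz => x; rewrite e => -> m; exact: ract0l.
have [[a az]|nsucc] := pselect (exists a, ord_succ le a z); last first.
  have /Slim e : ord_limit le z by split=> // a az; apply: nsucc; exists a.
  by exfalso; apply: Bz => x; rewrite e => -[a /below]; apply.
have Sz := Ssucc _ _ az; have /below Sa := az.1.
have [x Sx Mx] : exists2 x, ideal_set (S z) x & ~ ann M x.
  by apply: contrapT => h; apply: Bz => x Sx; apply: contrapT => Mx; apply: h; exists x.
rewrite Sz in Sx; have [n [y [hy exy]]] := Sx.
have [i yi] : exists i, ~ ann M (repr (y i)).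
  apply: contrapT => h; apply: Mx.
  have hann := ideal_submod (ann_ideal M).
  apply: (submod_subl hann (y := \sum_(i < n) repr (y i))).
    apply: Sa; apply/quot_projE.
    rewrite exy (big_morph (quot_proj (S a)) (@quot_projD _ _) (quot_proj0 _)).
    by apply: eq_bigr => i _; rewrite quot_projK.
  move=> m; rewrite ract_sum big1 // => i _.
  have /contrapT yi : ~ ~ ann M (repr (y i)) by move=> nn; apply: h; exists i.
  exact: yi.
have [I [sI Iy]] := hy i.
by exists (S a), I, (repr (y i)); split=> //; rewrite quot_projK.
Qed.

Section SocleComponent.
Variables (J : ideal R) (I : set (regular_mod (quot_rng J))).
Hypothesis sI : simple_submodule I.

(** Here and in [socle_act_inj]: acting on [m] maps [I] onto [M], because the image is a nonzero
    submodule of [M], and injectively, because the kernel is a proper submodule of [I]. Elements of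
    [R] replace their classes since [M] is not given as a module over R/J. *)
Lemma socle_act_surj M (y : R) (m : M) : J `<=` ann M -> simple_module M ->
  I (quot_proj J y) -> ract y m <> 0 ->
  forall w : M, exists2 x : R, I (quot_proj J x) & ract x m = w.
Proof.
move=> JM [_ _ minM] Iy ym w; have [hI _ _] := sI.
pose Q : set M := [set w | exists2 x : R, I (quot_proj J x) & ract x m = w].
have hQ : is_submodule Q.
  split=> [|u v [x Ix <-] [x' Ix' <-]|a u [x Ix <-]].
  - exists 0; last exact: ract0l.
    by rewrite quot_proj0; exact: (submod0 hI).
  - by exists (x - x'); rewrite ?ractBl // quot_projB; exact: (submodB hI).
  - exists (a ** x); last by rewrite ractA.
    by rewrite quot_projM; exact: (submodM hI).
have [//|e|e] := minM Q hQ.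
  by case: ym; have : Q (ract y m) by [exists y]; rewrite e.
by have : Q w by rewrite e.
Qed.

Lemma socle_act_inj M (y : R) (m : M) : J `<=` ann M ->
  I (quot_proj J y) -> ract y m <> 0 ->
  forall x, I (quot_proj J x) -> ract x m = 0 <-> ideal_set J x.
Proof.
move=> JM Iy ym x Ix; split=> [xm|/JM //].
have [hI _ minI] := sI.
have lift (z : R) : ract (repr (quot_proj J z)) m = ract z m.
  apply/eqP; rewrite -subr_eq0 -ractBl; apply/eqP/JM/quot_projE.
  by rewrite quot_projK.
pose Q : set (regular_mod (quot_rng J)) :=
  [set u : quot_rng J | I u /\ ract (repr u) m = 0].
have hQ : is_submodule Q.
  split=> [|u v [Iu um] [Iv vm]|a u [Iu um]].
  - by split; [exact: (submod0 hI)|rewrite -(quot_proj0 J) lift ract0l].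
  - split; first exact: (submodB hI).
    rewrite -(quot_projK u) -(quot_projK v) -quot_projB lift ractBl um vm.
    exact: subrr.
  - split; first exact: (submodM hI).
    have := lift (repr a ** repr u).
    by rewrite quot_proj_rmul !quot_projK -ractA um ract0.
have [e|e] := minI Q hQ (fun z h => h.1).
  have : Q (quot_proj J x) by split=> //; rewrite lift.
  by rewrite e => /quot_proj_eq0.
have : Q (quot_proj J y) by rewrite e.
by case=> _; rewrite lift => /ym.
Qed.

(** Both modules are isomorphic to [I], and the composite sends [ract x m] to [ract x n]. *)
Lemma socle_component_iso M N (y : R) :
  simple_module M -> simple_module N -> J `<=` ann M -> J `<=` ann N ->
  I (quot_proj J y) -> ~ ann M y -> ~ ann N y -> module_iso M N.
Proof.
move=> sM sN JM JN Iy nMy nNy; have [hI _ _] := sI.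
have [m ym] : exists m : M, ract y m <> 0.
  by apply: contrapT => h; apply: nMy => m; apply: contrapT => ?; apply: h; exists m.
have [n yn] : exists n : N, ract y n <> 0.
  by apply: contrapT => h; apply: nNy => n; apply: contrapT => ?; apply: h; exists n.
have sjM := socle_act_surj JM sM Iy ym; have sjN := socle_act_surj JN sN Iy yn.
have kM := socle_act_inj JM Iy ym; have kN := socle_act_inj JN Iy yn.
pose l w := s2val (cid2 (sjM w)); pose l' w := s2val (cid2 (sjN w)).
have lI w : I (quot_proj J (l w)) by rewrite /l; case: cid2.
have lm w : ract (l w) m = w by rewrite /l; case: cid2.
have lI' w : I (quot_proj J (l' w)) by rewrite /l'; case: cid2.
have lm' w : ract (l' w) n = w by rewrite /l'; case: cid2.
have transfer x x' : I (quot_proj J x) -> I (quot_proj J x') ->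
    ract x m = ract x' m <-> ract x n = ract x' n.
  move=> Ix Ix'; have Id : I (quot_proj J (x - x')).
    by rewrite quot_projB; exact: (submodB hI).
  have := kM _ Id; rewrite -(kN _ Id) !ractBl => h.
  by split=> e; apply/eqP; rewrite -subr_eq0; apply/eqP; apply/h; rewrite e subrr.
pose f w := ract (l w) n; pose g w := ract (l' w) m.
have fB : {morph f : u v / u - v}.
  move=> u v; rewrite /f -ractBl; apply/transfer => //.
    by rewrite quot_projB; exact: (submodB hI).
  by rewrite ractBl !lm.
pose fadd : {additive M -> N} :=
  HB.pack f (GRing.isZmodMorphism.Build _ _ f fB).
exists fadd; split.
  exists g => w /=.
    by rewrite -[RHS]lm /g; apply/transfer; rewrite // lm'.
  by rewrite -[RHS]lm' /f; apply/transfer; rewrite // lm.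
move=> a w /=; rewrite /f ractA; apply/transfer => //.
  by rewrite quot_projM; exact: (submodM hI).
by rewrite -ractA !lm.
Qed.

End SocleComponent.

Lemma semi_artinian_ann_iso M N : semi_artinian R ->
  simple_module M -> simple_module N -> ann M = ann N -> module_iso M N.
Proof.
move=> saR sM sN e; have [J [I [y [JM sI Iy My]]]] := semi_artinian_socle saR sM.
by apply: (socle_component_iso sI sM sN JM _ Iy My); rewrite -e.
Qed.

Lemma finitely_many_simple_of_semi_artinian : semi_artinian R ->
  finite_set [set I : set R | is_ideal I] -> finitely_many_simple_left_modules R.
Proof.
move=> saR /finite_seqP[s es].
suff [n [S [sS hS]]] : exists (n : nat) (S : 'I_n -> rngModType R),
    (forall i, simple_module (S i)) /\
    forall M, simple_module M -> ann M \in s -> exists i, module_iso M (S i).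
  exists n, S; split=> // M sM; apply: hS => //.
  have : [set I : set R | is_ideal I] (ann M) by exact: ann_ideal.
  by rewrite es.
elim: s {es} => [|P s [n [S [sS hS]]]].
  by exists 0%N, (fun i : 'I_0 => False_rect _ (ltac:(by case: i))); split=> // -[].
(* By [semi_artinian_ann_iso], one module for each ideal occurring as an annihilator is enough. *)
have [[M0 [sM0 eP]]|nP] := pselect (exists M0, simple_module M0 /\ ann M0 = P).
  exists n.+1, (fun i => if unlift ord0 i is Some j then S j else M0).
  split=> [i|M sM]; first by case: unliftP.
  rewrite inE => /orP[/eqP eM|/hS[//|i iM]].
    exists ord0; rewrite unlift_none.
    by apply: semi_artinian_ann_iso => //; rewrite eM.
  by exists (lift ord0 i); rewrite liftK.
exists n, S; split=> // M sM; rewrite inE => /orP[/eqP eM|]; last exact: hS.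
by case: nP; exists M.
Qed.

End Annihilator.

(** * Transport of simple modules along a ring isomorphism *)

Section RestrictScalars.
Variables (R R' : rngType) (phi : R -> R').
Hypothesis phiD : {morph phi : x y / x + y}.
Hypothesis phiM : {morph phi : x y / x ** y}.

(** The two proofs are phantom arguments, as in [submod_pred]: they let the module structure be
    inferred from the type. *)
Definition restrict_mod of {morph phi : x y / x + y} & {morph phi : x y / x ** y} :=
  fun M : Type => M.

Section Instance.
Variable M : rngModType R'.
Local Notation rM := (restrict_mod phiD phiM M).
HB.instance Definition _ := GRing.Zmodule.on rM.

Definition restrict_act (a : R) (x : rM) : rM := ract (phi a) (x : M).

Fact restrict_actA a b x : restrict_act a (restrict_act b x) = restrict_act (a ** b) x.
Proof. by rewrite /restrict_act ractA phiM. Qed.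

Fact restrict_actDl x : {morph restrict_act^~ x : a b / a + b}.
Proof. by move=> a b; rewrite /restrict_act phiD ractDl. Qed.

Fact restrict_actDr a : {morph restrict_act a : x y / x + y}.
Proof. by move=> x y; rewrite /restrict_act ractDr. Qed.

HB.instance Definition _ := Zmodule_isRngModule.Build R rM
  restrict_actA restrict_actDl restrict_actDr.

End Instance.

Lemma restrict_simple (M : rngModType R') : (forall b, exists a, phi a = b) ->
  simple_module M -> simple_module (restrict_mod phiD phiM M).
Proof.
move=> surj [_ [b [x [_ bx]]] minM].
have [a ea] := surj b.
split; first by split.
  by exists a, x; split=> //; rewrite /ract /= /restrict_act ea.
move=> N [N0 NB NM] _; apply: minM => //; split=> // {ea} c y Ny.
by have [a' <-] := surj c; exact: NM.
Qed.

End RestrictScalars.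

Lemma finitely_many_simple_iso (R R' : rngType) (phi : R -> R') (psi : R' -> R) :
  {morph phi : x y / x + y} -> {morph phi : x y / x ** y} ->
  cancel phi psi -> cancel psi phi ->
  finitely_many_simple_left_modules R' -> finitely_many_simple_left_modules R.
Proof.
move=> phiD phiM phiK psiK [n [S [sS hS]]].
have psiD : {morph psi : x y / x + y}.
  by move=> x y; apply: (can_inj phiK); rewrite phiD !psiK.
have psiM : {morph psi : x y / x ** y}.
  by move=> x y; apply: (can_inj phiK); rewrite phiM !psiK.
exists n, (fun i => restrict_mod phiD phiM (S i) : rngModType R); split=> [i|M sM].
  by apply: restrict_simple => // b; exists (psi b).
have [|i [f [bf fM]]] := hS (restrict_mod psiD psiM M).
  by apply: restrict_simple => // b; exists (phi b).
have fB : {morph (f : M -> restrict_mod phiD phiM (S i)) : x y / x - y}.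
  by move=> x y; exact: (raddfB f).
pose fadd : {additive M -> restrict_mod phiD phiM (S i)} :=
  HB.pack (f : M -> restrict_mod phiD phiM (S i)) (GRing.isZmodMorphism.Build _ _ _ fB).
exists i, fadd; split; first exact: bf.
by move=> a x; rewrite /= /ract /= /restrict_act -fM /ract /= /restrict_act phiK.
Qed.

Lemma rmul_sumr (R : rngType) (I : Type) (r : seq I) (P : pred I) (F : I -> R) (x : R) :
  x ** (\sum_(i <- r | P i) F i) = \sum_(i <- r | P i) x ** F i.
Proof. by apply: (big_morph (fun y => x ** y)); [exact: rmulDr|exact: rmul0]. Qed.

Lemma rmul_suml (R : rngType) (I : Type) (r : seq I) (P : pred I) (F : I -> R) (x : R) :
  (\sum_(i <- r | P i) F i) ** x = \sum_(i <- r | P i) F i ** x.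
Proof.
by apply: (big_morph (fun y => y ** x)); [move=> y z; exact: rmulDl|exact: rmul0l].
Qed.

(** * Reduction modulo an ideal in an acyclic graph *)

HB.instance Definition _ (E : digraph) := gen_eqMixin (vertex E).
HB.instance Definition _ (E : digraph) := gen_eqMixin (edge E).

Section Paths.
Variables (E : digraph) (K : fieldType).
Local Notation L := (lpa E K).
Implicit Types (u v w : vertex E) (e f : edge E) (s t : seq (edge E)) (x y z : L).

Definition lvert v : L := lpa_class (tvertex K v).
Definition ledge e : L := lpa_class (tedge K e).
Definition lghost e : L := lpa_class (tghost K e).

Lemma lpa_classM (a b : lpa_term E K) :
  lpa_class (tmul a b) = lpa_class a ** lpa_class b.
Proof. by rewrite /rmul /= lpa_mulE. Qed.

Lemma lpa_classD (a b : lpa_term E K) :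
  lpa_class (tadd a b) = lpa_class a + lpa_class b.
Proof. by rewrite /GRing.add /= lpa_addE. Qed.

Lemma lpa_classN (a : lpa_term E K) : lpa_class (topp a) = - lpa_class a.
Proof. by rewrite /GRing.opp /= lpa_oppE. Qed.

Lemma lpa_classZ k (a : lpa_term E K) : lpa_class (tscale k a) = k *: lpa_class a.
Proof. by rewrite /GRing.scale /= lpa_scaleE. Qed.

Lemma lpa_class0 : lpa_class (tzero E K) = 0 :> L.
Proof. by []. Qed.

Lemma lpa_elim (P : L -> Prop) :
  (forall v, P (lvert v)) -> (forall e, P (ledge e)) -> (forall e, P (lghost e)) ->
  P 0 -> (forall x y, P x -> P y -> P (x + y)) -> (forall x, P x -> P (- x)) ->
  (forall k x, P x -> P (k *: x)) -> (forall x y, P x -> P y -> P (x ** y)) ->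
  forall x, P x.
Proof.
move=> Pv Pe Pg P0 PD PN PZ PM; elim/lpa_ind => a.
elim: a => // [a IHa b IHb|a IHa|k a IHa|a IHa b IHb].
- by rewrite lpa_classD; exact: PD.
- by rewrite lpa_classN; exact: PN.
- by rewrite lpa_classZ; exact: PZ.
- by rewrite lpa_classM; exact: PM.
Qed.

Lemma lvert_idem v : lvert v ** lvert v = lvert v.
Proof. by rewrite -lpa_classM; apply/lpa_classE; constructor. Qed.

Lemma lvert_mul v w : lvert v ** lvert w = if v == w then lvert v else 0.
Proof.
case: eqP => [<-|vw]; first exact: lvert_idem.
by rewrite -lpa_classM; apply/lpa_classE; constructor.
Qed.

Lemma lvert_edge e : lvert (esource e) ** ledge e = ledge e.
Proof. by rewrite -lpa_classM; apply/lpa_classE; constructor. Qed.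

Lemma ledge_vert e : ledge e ** lvert (erange e) = ledge e.
Proof. by rewrite -lpa_classM; apply/lpa_classE; constructor. Qed.

Lemma lvert_ghost e : lvert (erange e) ** lghost e = lghost e.
Proof. by rewrite -lpa_classM; apply/lpa_classE; constructor. Qed.

Lemma lghost_vert e : lghost e ** lvert (esource e) = lghost e.
Proof. by rewrite -lpa_classM; apply/lpa_classE; constructor. Qed.

Lemma lghost_edge e f :
  lghost e ** ledge f = if e == f then lvert (erange e) else 0.
Proof.
case: eqP => [<-|ef]; rewrite -lpa_classM; apply/lpa_classE; first by constructor.
by constructor.
Qed.

Lemma lvert_edge_if v e :
  lvert v ** ledge e = if v == esource e then ledge e else 0.
Proof.
rewrite -{1}lvert_edge rmulA lvert_mul; case: eqP => [->|_].
  exact: lvert_edge.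
exact: rmul0l.
Qed.

Lemma lghost_vert_if v e :
  lghost e ** lvert v = if v == esource e then lghost e else 0.
Proof.
rewrite -{1}lghost_vert -rmulA lvert_mul eq_sym; case: eqP => _.
  exact: lghost_vert.
exact: rmul0.
Qed.

Fixpoint vpath u s w : bool :=
  if s is e :: s' then (esource e == u) && vpath (erange e) s' w else u == w.

(** The end [w] is an argument because the empty path has to denote a vertex. [lcopath] is the image
    of [lpath] under the involution. *)
Definition lpath s w : L := foldr (fun e x => ledge e ** x) (lvert w) s.
Definition lcopath s w : L := foldr (fun e x => x ** lghost e) (lvert w) s.

Lemma vpath_cat u s t w :
  vpath u (s ++ t) w <-> exists2 v, vpath u s v & vpath v t w.
Proof.
elim: s u => [|e s IHs] u /=.
  by split=> [h|[v /eqP ->]//]; exists u.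
split=> [/andP[eu /IHs[v h1 h2]]|[v /andP[eu h1] h2]].
  by exists v; rewrite ?eu.
by rewrite eu; apply/IHs; exists v.
Qed.

Lemma lpath_vert s w : lpath s w ** lvert w = lpath s w.
Proof.
by elim: s => [|e s IHs] /=; [exact: lvert_idem|rewrite -rmulA IHs].
Qed.

Lemma lpath_vert_if s w v : lpath s w ** lvert v = if v == w then lpath s w else 0.
Proof.
rewrite -{1}lpath_vert -rmulA lvert_mul eq_sym; case: eqP => _.
  exact: lpath_vert.
exact: rmul0.
Qed.

Lemma lvert_path u s w : vpath u s w -> lvert u ** lpath s w = lpath s w.
Proof.
case: s => [/eqP ->|e s /andP[/eqP <- _]] /=; first exact: lvert_idem.
by rewrite rmulA lvert_edge.
Qed.

Lemma lvert_path_if u s w v : vpath u s w ->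
  lvert v ** lpath s w = if v == u then lpath s w else 0.
Proof.
move=> h; rewrite -{1}(lvert_path h) rmulA lvert_mul; case: eqP => [->|_].
  exact: lvert_path.
exact: rmul0l.
Qed.

Lemma lpath_cat s t u w : vpath u t w ->
  lpath s u ** lpath t w = lpath (s ++ t) w.
Proof.
move=> h; elim: s => [|e s IHs] /=; first exact: lvert_path.
by rewrite -rmulA IHs.
Qed.

Lemma lpath1 e : lpath [:: e] (erange e) = ledge e.
Proof. exact: ledge_vert. Qed.

Lemma lcopath_path u s w : vpath u s w -> lcopath s w ** lpath s w = lvert w.
Proof.
elim: s u => [|e s IHs] u /=; first by move=> _; exact: lvert_idem.
move=> /andP[_ h]; rewrite rmulA -(rmulA (lcopath s w)) lghost_edge eqxx.
by rewrite -rmulA (lvert_path h) (IHs _ h).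
Qed.

Definition acyclic := forall v s, vpath v s v -> s = [::].

Hypothesis acyE : acyclic.

(** If one of two paths with the same end were a proper initial segment of the other, the remainder
    would be a closed path. So they start at different vertices or part at two distinct edges, where
    e^* f = 0. *)
Lemma lcopath_path_neq u v s t w : vpath u s w -> vpath v t w -> s <> t ->
  lcopath s w ** lpath t w = 0.
Proof.
elim: s u v t => [|e s IHs] u v [|f t] //=.
- move=> _ /andP[/eqP fv h] _; rewrite rmulA lvert_edge_if.
  case: eqP => [ew|_]; last exact: rmul0l.
  by have := @acyE w (f :: t); rewrite /= -ew eqxx h => /(_ isT).
- move=> /andP[/eqP eu h] _ _; rewrite -rmulA lghost_vert_if.
  case: eqP => [ew|_]; last exact: rmul0.
  by have := @acyE w (e :: s); rewrite /= -ew eqxx h => /(_ isT).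
- move=> /andP[_ hs] /andP[_ ht] ne.
  rewrite rmulA -(rmulA (lcopath s w)) lghost_edge.
  case: eqP => [ef|_]; last by rewrite rmul0 rmul0l.
  rewrite -rmulA ef (lvert_path ht); apply: (IHs _ _ _ hs ht) => st.
  by apply: ne; rewrite ef st.
Qed.

(* [ghost_deg m x]: [x] is a combination of monomials p q^* with [q] of length at
   most [m]. *)
Inductive ghost_deg : nat -> L -> Prop :=
| gd_path m u s w : vpath u s w -> ghost_deg m (lpath s w)
| gd_ghost m x e : ghost_deg m x -> ghost_deg m.+1 (x ** lghost e)
| gd_0 m : ghost_deg m 0
| gd_add m x y : ghost_deg m x -> ghost_deg m y -> ghost_deg m (x + y)
| gd_scale m k x : ghost_deg m x -> ghost_deg m (k *: x).

Lemma ghost_deg_leq m n x : (m <= n)%N -> ghost_deg m x -> ghost_deg n x.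
Proof.
move=> mn h; elim: h n mn => {m x}.
- by move=> m u s w h n _; exact: gd_path h.
- by move=> m x e _ IH [//|n] mn; apply: gd_ghost; exact: IH.
- by move=> m n _; exact: gd_0.
- by move=> m x y _ IHx _ IHy n mn; apply: gd_add; [exact: IHx|exact: IHy].
- by move=> m k x _ IHx n mn; apply: gd_scale; exact: IHx.
Qed.

Lemma ghost_deg_vert m x v : ghost_deg m x -> ghost_deg m (x ** lvert v).
Proof.
elim=> {m x}.
- move=> m u s w h; rewrite lpath_vert_if; case: eqP => _; last exact: gd_0.
  exact: gd_path h.
- move=> m x e h _; rewrite -rmulA lghost_vert_if; case: eqP => _.
    exact: gd_ghost.
  by rewrite rmul0; exact: gd_0.
- by move=> m; rewrite rmul0l; exact: gd_0.
- by move=> m x y _ hx _ hy; rewrite rmulDl; exact: gd_add.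
- by move=> m k x _ hx; rewrite -lpa_scalerAl; exact: gd_scale.
Qed.

(** An edge on the right cancels the last ghost or, if there is none, prolongs the path. The
    inductions in [reduce_mod] and [simple_line] run on this drop in degree. *)
Lemma ghost_deg_edge m x f : ghost_deg m x -> ghost_deg m.-1 (x ** ledge f).
Proof.
elim=> {m x}.
- move=> m u s w h; have [e|ne] := eqVneq w (esource f).
    have h1 : vpath w [:: f] (erange f) by rewrite /= e !eqxx.
    rewrite -lpath1 (lpath_cat _ h1); apply: (@gd_path _ u).
    by apply/vpath_cat; exists w.
  rewrite -lpath_vert -rmulA lvert_edge_if (negbTE ne) rmul0; exact: gd_0.
- move=> m x e h _; rewrite -rmulA lghost_edge; case: eqP => _.
    exact: ghost_deg_vert.
  by rewrite rmul0; exact: gd_0.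
- by move=> m; rewrite rmul0l; exact: gd_0.
- by move=> m x y _ hx _ hy; rewrite rmulDl; exact: gd_add.
- by move=> m k x _ hx; rewrite -lpa_scalerAl; exact: gd_scale.
Qed.

(** Left multiplication commutes with appending a ghost, so only real paths need checking; the
    degree can grow, hence the existential. *)
Lemma ghost_deg_lmul (a : L) m x :
  (forall u s w, vpath u s w -> exists n, ghost_deg n (a ** lpath s w)) ->
  ghost_deg m x -> exists n, ghost_deg n (a ** x).
Proof.
move=> ha; elim=> {m x}.
- by move=> m u s w /ha.
- by move=> m x e _ [n hn]; exists n.+1; rewrite rmulA; exact: gd_ghost.
- by exists 0%N; rewrite rmul0; exact: gd_0.
- move=> m x y _ [i hi] _ [j hj]; exists (maxn i j); rewrite rmulDr.
  apply: gd_add; first exact: ghost_deg_leq (leq_maxl _ _) hi.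
  exact: ghost_deg_leq (leq_maxr _ _) hj.
- by move=> m k x _ [n hn]; exists n; rewrite -lpa_scalerAr; exact: gd_scale.
Qed.

Lemma ghost_deg_mul (a : L) m x : ghost_deg m x -> exists n, ghost_deg n (a ** x).
Proof.
elim/lpa_elim: a m x.
- move=> v m x; apply: ghost_deg_lmul => u s w h; exists 0%N.
  rewrite (lvert_path_if _ h); case: eqP => _; last exact: gd_0.
  exact: gd_path h.
- move=> e m x; apply: ghost_deg_lmul => u s w h; exists 0%N.
  rewrite -ledge_vert -rmulA (lvert_path_if _ h).
  case: eqP => eu; last by rewrite rmul0; exact: gd_0.
  apply: (@gd_path _ (esource e) (e :: s)).
  by rewrite /= eqxx eu.
- move=> e m x; apply: ghost_deg_lmul => u [|f s] w /= h.
    exists 1%N; rewrite lghost_vert_if; case: eqP => _; last exact: gd_0.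
    rewrite -lvert_ghost; apply: gd_ghost.
    by apply: (@gd_path _ (erange e) [::]) => /=.
  exists 0%N; rewrite rmulA lghost_edge; case: eqP => [->|_]; last first.
    by rewrite rmul0l; exact: gd_0.
  have /andP[_ h'] := h; rewrite (lvert_path h'); exact: gd_path h'.
- by move=> m x _; exists 0%N; rewrite rmul0l; exact: gd_0.
- move=> a b IHa IHb m x hx; have [i hi] := IHa m x hx; have [j hj] := IHb m x hx.
  exists (maxn i j); rewrite rmulDl.
  apply: gd_add; first exact: ghost_deg_leq (leq_maxl _ _) hi.
  exact: ghost_deg_leq (leq_maxr _ _) hj.
- move=> a IHa m x hx; have [i hi] := IHa m x hx; exists i.
  by rewrite rmulNl -scaleN1r; exact: gd_scale.
- move=> k a IHa m x hx; have [i hi] := IHa m x hx; exists i.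
  by rewrite -lpa_scalerAl; exact: gd_scale.
- move=> a b IHa IHb m x hx; have [j hj] := IHb m x hx.
  by rewrite -rmulA; exact: IHa hj.
Qed.

(** Finite sums of vertices replace the missing unit. Allowing every larger [vs'] is what makes the
    induction pass through sums. *)
Lemma local_unit x : exists vs : seq (vertex E), forall vs', uniq vs' ->
  {subset vs <= vs'} -> x ** (\sum_(v <- vs') lvert v) = x.
Proof.
have unit1 y w : y ** lvert w = y -> exists vs : seq (vertex E), forall vs', uniq vs' ->
    {subset vs <= vs'} -> y ** (\sum_(v <- vs') lvert v) = y.
  move=> yw; exists [:: w] => vs uvs sub.
  have wvs : w \in vs by apply: sub; rewrite inE.
  rewrite (bigD1_seq w) //= rmulDr yw -[X in X ** (\sum_(_ <- _ | _) _)]yw -rmulA.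
  rewrite rmul_sumr big1 ?rmul0 ?addr0 // => v vw.
  by rewrite lvert_mul eq_sym (negbTE vw).
elim/lpa_elim: x.
- by move=> v; apply: unit1 (lvert_idem v).
- by move=> e; apply: unit1 (ledge_vert e).
- by move=> e; apply: unit1 (lghost_vert e).
- by exists [::] => *; rewrite rmul0l.
- move=> x y [vs hx] [ws hy]; exists (vs ++ ws) => us u sub.
  rewrite rmulDl hx // ?hy // => v h; apply: sub; rewrite mem_cat h ?orbT //.
- by move=> x [vs hx]; exists vs => us u sub; rewrite rmulNl hx.
- by move=> k x [vs hx]; exists vs => us u sub; rewrite -lpa_scalerAl hx.
- by move=> x y _ [vs hy]; exists vs => us u sub; rewrite -rmulA hy.
Qed.

Lemma local_unitE x : exists vs : seq (vertex E), x = x ** (\sum_(v <- vs) lvert v).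
Proof.
have [vs h] := local_unit x; exists (undup vs); rewrite h //; first exact: undup_uniq.
by move=> v; rewrite mem_undup.
Qed.

Lemma ghost_deg_exists x : exists m, ghost_deg m x.
Proof.
have [vs ->] := local_unitE x; apply: (@ghost_deg_mul _ 0%N).
elim: vs => [|v vs IH]; first by rewrite big_nil; exact: gd_0.
rewrite big_cons; apply: gd_add => //.
by apply: (@gd_path _ v [::]) => /=.
Qed.

Lemma ideal_sum (I : set L) (T : Type) (r : seq T) (P : pred T) (F : T -> L) :
  is_ideal I -> (forall i, P i -> I (F i)) -> I (\sum_(i <- r | P i) F i).
Proof.
move=> hI hF; apply: big_ind => //; first exact: submod0 (ideal_submod hI).
exact: submodD (ideal_submod hI).
Qed.

Lemma vert_notin (I : set L) x : is_ideal I -> ~ I x -> exists v, ~ I (x ** lvert v).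
Proof.
move=> hI; apply: contra_notP => h; have [vs ->] := local_unitE x.
rewrite rmul_sumr; apply: ideal_sum => // v _.
by apply: contrapT => hv; apply: h; exists v.
Qed.

(* What the edges of [A] leave out of relation (CK2) at [u]. *)
Definition gap u (A : seq (edge E)) : L :=
  lvert u - \sum_(e <- undup A | esource e == u) ledge e ** lghost e.

Lemma gap_nil u : gap u [::] = lvert u.
Proof. by rewrite /gap big_nil subr0. Qed.

Lemma gap_vert u A : gap u A ** lvert u = gap u A.
Proof.
rewrite /gap rmulBl lvert_idem rmul_suml; congr (_ - _).
by apply: eq_bigr => e /eqP eu; rewrite -rmulA -{1}eu lghost_vert.
Qed.

Lemma vert_gap u A : lvert u ** gap u A = gap u A.
Proof.
rewrite /gap rmulBr lvert_idem rmul_sumr; congr (_ - _).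
by apply: eq_bigr => e /eqP eu; rewrite rmulA -{1}eu lvert_edge.
Qed.

Lemma ghost_gap u A f : f \in A -> lghost f ** gap u A = 0.
Proof.
move=> fA; have [eu|ne] := eqVneq (esource f) u; last first.
  by rewrite -vert_gap rmulA lghost_vert_if eq_sym (negbTE ne) rmul0l.
rewrite /gap rmulBr -{1}eu lghost_vert rmul_sumr.
rewrite -big_filter (bigD1_seq f) ?filter_uniq ?undup_uniq //=; last first.
  by rewrite mem_filter eu eqxx mem_undup.
rewrite big1 ?addr0 => [|e ef].
  by rewrite rmulA lghost_edge eqxx lvert_ghost subrr.
by rewrite rmulA lghost_edge eq_sym (negbTE ef) rmul0l.
Qed.

Lemma gap_edge u A f : f \in A -> gap u A ** ledge f = 0.
Proof.
move=> fA; have [eu|ne] := eqVneq (esource f) u; last first.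
  by rewrite -gap_vert -rmulA lvert_edge_if eq_sym (negbTE ne) rmul0.
rewrite /gap rmulBl -{1}eu lvert_edge rmul_suml.
rewrite -big_filter (bigD1_seq f) ?filter_uniq ?undup_uniq //=; last first.
  by rewrite mem_filter eu eqxx mem_undup.
rewrite big1 ?addr0 => [|e ef].
  by rewrite -rmulA lghost_edge eqxx ledge_vert subrr.
by rewrite -rmulA lghost_edge (negbTE ef) rmul0.
Qed.

Lemma gap_sub u A B : {subset A <= B} -> gap u A ** gap u B = gap u B.
Proof.
move=> sub; rewrite {1}/gap rmulBl vert_gap rmul_suml big1_seq ?subr0 // => e.
rewrite mem_undup => /andP[_ eA]; by rewrite -rmulA ghost_gap ?rmul0 // sub.
Qed.

Lemma gap_idem u A : gap u A ** gap u A = gap u A.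
Proof. exact: gap_sub. Qed.

Lemma mul_gapE x u A : x ** gap u A =
  x ** lvert u - \sum_(e <- undup A | esource e == u) (x ** ledge e) ** lghost e.
Proof.
by rewrite {1}/gap rmulBr rmul_sumr; congr (_ - _); apply: eq_bigr => e _; rewrite rmulA.
Qed.

(** A monomial ending in e^* is killed by [gap u B] as soon as [B] contains e. With the last ghosts
    of all monomials collected in [A], only the ghost-free part [x0] survives. *)
Lemma ghost_deg_gap m x : ghost_deg m x -> exists2 x0, ghost_deg 0 x0 &
  exists A : seq (edge E), forall u B, {subset A <= B} -> x ** gap u B = x0 ** gap u B.
Proof.
elim=> {m x}.
- by move=> m u s w h; exists (lpath s w); [exact: gd_path h|exists [::]].
- move=> m x e _ _; exists 0; first exact: gd_0.
  exists [:: e] => u B sub; rewrite -rmulA ghost_gap ?rmul0 ?rmul0l //.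
  by apply: sub; rewrite inE.
- by move=> m; exists 0; [exact: gd_0|exists [::]].
- move=> m x y _ [x0 hx [A hA]] _ [y0 hy [B hB]].
  exists (x0 + y0); first exact: gd_add.
  exists (A ++ B) => u C sub; rewrite !rmulDl hA ?hB // => e h; apply: sub;
  by rewrite mem_cat h ?orbT.
- move=> m k x _ [x0 hx [A hA]]; exists (k *: x0); first exact: gd_scale.
  by exists A => u B sub; rewrite -!lpa_scalerAl hA.
Qed.

Definition real_sum u (l : seq (K * seq (edge E))) : L :=
  \sum_(p <- l) p.1 *: lpath p.2 u.

Definition ends_at u (l : seq (K * seq (edge E))) : Prop :=
  forall p, p \in l -> exists w, vpath w p.2 u.

Lemma ghost_deg0_real x u : ghost_deg 0 x ->
  exists2 l, ends_at u l & x ** lvert u = real_sum u l.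
Proof.
move em : 0%N => m h; elim: h em => {m x}.
- move=> m v s w h _; rewrite lpath_vert_if; case: eqP => [->|_].
    exists [:: (1, s)]; last by rewrite /real_sum big_seq1 scale1r.
    by move=> p; rewrite inE => /eqP ->; exists v.
  by exists [::]; rewrite /real_sum ?big_nil.
- by [].
- by exists [::]; rewrite /real_sum ?big_nil ?rmul0l.
- move=> m x y _ IHx _ IHy e0; have [l hl el] := IHx e0; have [l' hl' el'] := IHy e0.
  exists (l ++ l'); last by rewrite rmulDl el el' /real_sum big_cat.
  by move=> p; rewrite mem_cat => /orP[/hl|/hl'].
- move=> m k x _ IHx e0; have [l hl el] := IHx e0.
  exists [seq (k * p.1, p.2) | p <- l].
    by move=> p /mapP[q /hl h ->].
  rewrite -lpa_scalerAl el /real_sum big_map scaler_sumr.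
  by apply: eq_bigr => p _; rewrite scalerA.
Qed.

(* Distinct paths ending at [u] are orthogonal because there are no closed paths, so
   multiplication by the ghost of one of them isolates its coefficient. *)
Lemma real_sum_reduce u l g : ends_at u l -> lvert u ** g = g ->
  real_sum u l ** g <> 0 -> exists y, y ** real_sum u l ** g = g.
Proof.
move=> + ug; have [n] := ubnP (size l); elim: n l => // n IH [|[k s] l] sz hl.
  by rewrite /real_sum big_nil rmul0l.
(* The list may repeat a path, so [c] gathers all coefficients of [s]. If [c] vanishes, dropping
   every copy of [s] shortens the list; otherwise it can be inverted. *)
move=> ne; pose c := \sum_(p <- (k, s) :: l | p.2 == s) p.1.
have [w hs] := hl (k, s) (mem_head _ _).
have split_s : real_sum u ((k, s) :: l) =
    c *: lpath s u + \sum_(p <- (k, s) :: l | p.2 != s) p.1 *: lpath p.2 u.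
  rewrite /real_sum (bigID (fun p => p.2 == s)) /=; congr (_ + _).
  by rewrite /c scaler_suml; apply: eq_bigr => p /eqP ->.
have [c0|c0] := eqVneq c 0.
  move: ne; rewrite split_s c0 scale0r add0r -big_filter => ne.
  apply: (IH [seq p <- (k, s) :: l | p.2 != s]) => //.
    rewrite /= eqxx /=; apply: (@leq_ltn_trans (size l)); last exact: sz.
    by rewrite size_filter; exact: count_size.
  by move=> p; rewrite mem_filter => /andP[_ /hl].
exists (c^-1 *: lcopath s u).
rewrite split_s rmulDr -lpa_scalerAr -lpa_scalerAl (lcopath_path hs).
rewrite scalerA mulfV // scale1r rmul_sumr big1_seq ?addr0 // => p /andP[ps pl].
have [v hp] := hl p pl.
rewrite -lpa_scalerAr -lpa_scalerAl (lcopath_path_neq hs hp) ?scaler0 //.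
by move=> /= sp; rewrite sp eqxx in ps.
Qed.

Lemma gap_reduce x u A : ghost_deg 0 x -> x ** gap u A <> 0 ->
  exists y, y ** x ** gap u A = gap u A.
Proof.
move=> /(ghost_deg0_real u)[l hl el] ne.
have ex : x ** gap u A = real_sum u l ** gap u A by rewrite -el -rmulA vert_gap.
have [|y ey] := real_sum_reduce hl (vert_gap u A); first by rewrite -ex.
by exists y; rewrite -rmulA ex rmulA.
Qed.

Section Modulo.
Variable I : set L.
Hypothesis hI : is_ideal I.

Lemma idealMl a x : I x -> I (a ** x).
Proof. by case: hI => _ _ IM /(IM a)[]. Qed.

Lemma idealMr a x : I x -> I (x ** a).
Proof. by case: hI => _ _ IM /(IM a)[]. Qed.

Let sI := ideal_submod hI.

(* If [x] times [gap u A] is killed by all edges, then modulo [I] its ghost part is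
   absorbed by enlarging [A]. *)
Lemma reduce_stuck x u A :
  (forall f, I (x ** gap u A ** ledge f)) -> ~ I (x ** gap u A) ->
  exists y B, [/\ {subset A <= B}, ~ I (gap u B) & I (y ** x ** gap u A - gap u B)].
Proof.
move=> hf nx; have [m /ghost_deg_gap[x0 h0 [A0 hA0]]] := ghost_deg_exists x.
pose B := A ++ A0.
have subA : {subset A <= B} by move=> e h; rewrite mem_cat h.
have subA0 : {subset A0 <= B} by move=> e h; rewrite mem_cat h orbT.
(* Multiplying [x ** gap u A] by [gap u B] changes it only by terms x (gap u A) e e^* in [I], while
   [x ** gap u B] equals [x0 ** gap u B]. *)
have d : I (x ** gap u A - x0 ** gap u B).
  rewrite -hA0 // -(gap_sub u subA) rmulA [X in _ - X]mul_gapE -rmulA gap_vert subKr.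
  by apply: ideal_sum => // e _; apply: idealMr; exact: hf.
have nx0 : ~ I (x0 ** gap u B) by move=> h; apply: nx; exact: (submod_subl sI d).
have [|y ey] := gap_reduce h0 (A := B) (u := u).
  by move=> e0; apply: nx0; rewrite e0; exact: submod0 sI.
exists y, B; split=> //; first by move=> /(idealMl x0).
by rewrite -ey -!rmulA -rmulBr; exact: idealMl.
Qed.

(** Induction on the ghost degree: while some edge on the right keeps the element outside [I], that
    edge lowers the degree; when none does, [reduce_stuck] applies. *)
Lemma reduce_mod x : ~ I x ->
  exists y z u B, ~ I (gap u B) /\ I (y ** x ** z - gap u B).
Proof.
have [m] := ghost_deg_exists x; elim: m x => [|m IH] x hx nx.
  have [u nu] := vert_notin hI nx; rewrite -gap_nil in nu.
  have [|y ey] := gap_reduce hx (A := [::]) (u := u).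
    by move=> e0; apply: nu; rewrite e0; exact: submod0 sI.
  exists y, (gap u [::]), u, [::]; split; first by move=> /(idealMl x).
  by rewrite ey subrr; exact: submod0 sI.
have [u nu] := vert_notin hI nx.
have [[f nf]|stuck] := pselect (exists f, ~ I (x ** lvert u ** ledge f)).
  have [y [z [v [B [nB h]]]]] := IH _ (ghost_deg_edge f (ghost_deg_vert u hx)) nf.
  by exists y, (lvert u ** ledge f ** z), v, B; rewrite !rmulA in h *.
rewrite -gap_nil in nu.
have [|y [B [_ nB h]]] := reduce_stuck _ nu.
  by move=> f; apply: contrapT => nf; apply: stuck; exists f; rewrite -gap_nil.
by exists y, (gap u [::]), u, B.
Qed.

(** The set [B] given by [reduce_stuck] enlarges [A] only by edges e with (gap u A) e in [I], so
    [gap u B] and [gap u A] agree modulo [I]. *)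
Lemma simple_gap u A : (forall e, esource e = u -> e \notin A -> I (ledge e)) ->
  forall x, ~ I (x ** gap u A) -> exists y, I (y ** x ** gap u A - gap u A).
Proof.
move=> hA x nx; have [|y [B [AB _ h]]] := reduce_stuck _ nx.
  move=> f; have [fA|fA] := boolP (f \in A).
    by rewrite -rmulA gap_edge // rmul0; exact: submod0 sI.
  have [fu|fu] := eqVneq (esource f) u; first by apply: idealMl; exact: hA.
  rewrite -gap_vert -!rmulA lvert_edge_if eq_sym (negbTE fu) !rmul0.
  exact: submod0 sI.
exists y; apply: (submod_trans sI h).
rewrite -{1}(gap_sub u AB) mul_gapE gap_vert addrAC subrr sub0r; apply: submodN => //.
apply: ideal_sum => // e /eqP eu; apply: idealMr.
have [eA|eA] := boolP (e \in A).
  by rewrite gap_edge //; exact: submod0 sI.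
by apply: idealMl; exact: hA.
Qed.

(** Modulo [I], each vertex of [P] is e e^* for a single edge e leading back into [P]. Moving [x]
    along these edges removes its ghosts, and a solution [y] at the range of e gives [ledge e ** y]
    at its source. *)
Lemma simple_line (P : set (vertex E)) (nxt : vertex E -> edge E) :
  (forall u, P u -> [/\ esource (nxt u) = u, P (erange (nxt u)) &
                        I (lvert u - ledge (nxt u) ** lghost (nxt u))]) ->
  forall u x, P u -> ~ I (x ** lvert u) -> exists y, I (y ** x ** lvert u - lvert u).
Proof.
move=> hP u x; have [m] := ghost_deg_exists x; elim: m u x => [|m IH] u x hx Pu nx.
  rewrite -gap_nil in nx *; have [|y ey] := gap_reduce hx (A := [::]) (u := u).
    by move=> e0; apply: nx; rewrite e0; exact: submod0 sI.
  by exists y; rewrite ey subrr; exact: submod0 sI.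
have [su Pr d] := hP u Pu; set e := nxt u in su Pr d.
have nxe : ~ I (x ** ledge e ** lvert (erange e)).
  rewrite -rmulA ledge_vert => h; apply: nx.
  apply: (submod_subl sI (y := x ** ledge e ** lghost e)); last exact: idealMr.
  by rewrite -rmulA -rmulBr; exact: idealMl.
have [y hy] := IH _ _ (ghost_deg_edge e hx) Pr nxe.
exists (ledge e ** y).
apply: (submod_trans sI (y := ledge e ** y ** x ** (ledge e ** lghost e))).
  by rewrite -rmulBr; exact: idealMl.
apply: (submod_trans sI (y := ledge e ** lghost e)); last first.
  by rewrite -opprB; exact: submodN.
have := idealMr (lghost e) (idealMl (ledge e) hy).
by rewrite rmulBr rmulBl -!rmulA lvert_ghost.
Qed.

End Modulo.

End Paths.

(** The last hypothesis recovers [g] from each nonzero multiple, so the class of [g] generates a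
    simple left ideal. *)
Lemma simple_socle (R : rngType) (I : ideal R) (g : R) :
  g ** g = g -> ~ ideal_set I g ->
  (forall x, ~ ideal_set I (x ** g) -> exists y, ideal_set I (y ** x ** g - g)) ->
  socle (quot_proj I g).
Proof.
move=> gg nIg hg; exists 1%N, (fun=> quot_proj I g); split; last by rewrite big_ord1.
move=> _; exists [set u : regular_mod (quot_rng I) | exists x, u = quot_proj I (x ** g)].
split; last by exists g; rewrite gg.
split.
- split=> [|_ _ [x ->] [y ->]|a _ [x ->]].
  + by exists 0; rewrite rmul0l quot_proj0.
  + by exists (x - y); rewrite rmulBl quot_projB.
  + exists (repr a ** x).
    by rewrite /ract /= /regular_act -rmulA [RHS]quot_proj_rmul quot_projK.
- exists (quot_proj I g), (quot_proj I g); split; first by exists g; rewrite gg.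
  by rewrite /ract /= /regular_act -quot_proj_rmul gg => /quot_proj_eq0.
- move=> N hN Nsub; have [[x [Nx nx]]|all0] :=
    pselect (exists x, N (quot_proj I (x ** g)) /\ ~ ideal_set I (x ** g)).
    right; apply/seteqP; split=> // _ [z ->].
    have [y hy] := hg x nx.
    have Ng : N (quot_proj I g).
      have := submodM hN (quot_proj I y) Nx.
      rewrite /ract /= /regular_act -quot_proj_rmul rmulA.
      by have /quot_projE -> := hy.
    have := submodM hN (quot_proj I z) Ng.
    by rewrite /ract /= /regular_act -quot_proj_rmul.
  left; apply/seteqP; split=> [z Nz|_ ->]; last exact: submod0 hN.
  have [x ez] := Nsub z Nz; rewrite ez in Nz *; apply/quot_proj_eq0.
  by apply: contrapT => nx; apply: all0; exists x.
Qed.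

Section SocleStep.
Variables (E : digraph) (K : fieldType).
Local Notation L := (lpa E K).

Definition branching (X : set (vertex E)) : Prop :=
  forall w, X w -> exists s e f, [/\ e <> f, vpath w s (esource e),
    esource f = esource e, X (erange e) & X (erange f)].

Hypothesis acyE : acyclic E.

Lemma socle_or_branching (I : ideal L) : I <> setT :> set L ->
  (exists2 x, ~ ideal_set I x & socle (quot_proj I x)) \/
  exists X, X !=set0 /\ branching X.
Proof.
move=> nT; have hI := idealP I.
have [v nv] : exists v, ~ ideal_set I (lvert K v).
  have [x nx] : exists x, ~ ideal_set I x.
    apply: contrapT => h; apply: nT; apply/seteqP; split=> // x _.
    by apply: contrapT => nx; apply: h; exists x.
  have [v nv] := vert_notin hI nx; exists v => /(idealMl hI x); exact.
have [[u [A [nA hA]]]|no_gap] := pselect (exists u A, ~ ideal_set I (gap K u A) /\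
    forall e, esource e = u -> e \notin A -> ideal_set I (ledge K e)).
  left; exists (gap K u A) => //; apply: simple_socle => //.
    exact: gap_idem.
  exact: simple_gap.
pose X := [set w | ~ ideal_set I (lvert K w)].
have XedgeP e : ~ X (erange e) -> ideal_set I (ledge K e).
  by move=> /contrapT; rewrite -ledge_vert; exact: idealMl.
have Xedge u : X u -> exists e, esource e = u /\ X (erange e).
  move=> Xu; apply: contrapT => h; apply: no_gap; exists u, [::].
  rewrite gap_nil; split=> // e eu _; apply: XedgeP => Xe; apply: h.
  by exists e.
(* If [X] does not branch, below some [w] in [X] no two different edges with the same source both
   end in [X]. *)
have [[w [Xw wuniq]]|br] := pselect (exists w, X w /\ forall s e f,
    vpath w s (esource e) -> esource f = esource e -> X (erange e) -> X (erange f) ->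
    e = f); last first.
  right; exists X; split; first by exists v.
  move=> w Xw; apply: contrapT => h; apply: br; exists w; split=> // s e f ps fe Xe Xf.
  by apply: contrapT => ef; apply: h; exists s, e, f.
left; pose P := [set u | X u /\ exists s, vpath w s u].
have [e0 _] := Xedge w Xw.
have /choice[nxt hnxt] u : exists e, P u -> esource e = u /\ X (erange e).
  by have [[/Xedge[e he] _]|nP] := pselect (P u); [exists e|exists e0].
exists (lvert K w) => //; apply: simple_socle => //; first exact: lvert_idem.
move=> x; apply: (simple_line acyE hI (P := P) (nxt := nxt)) => [u Pu|]; last first.
  by split=> //; exists [::]; rewrite /= eqxx.
have [su Xr] := hnxt u Pu; have [Xu [s ps]] := Pu; split=> //.
  split=> //; exists (s ++ [:: nxt u]); apply/vpath_cat; exists u => //.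
  by rewrite /= su !eqxx.
(* All other edges from [u] end outside [X] and so lie in [I]; a gap outside [I] is then the case
   already excluded. *)
apply: contrapT => nd; apply: no_gap; exists u, [:: nxt u]; split.
  by move: nd; rewrite /gap /= big_cons big_nil su eqxx addr0.
move=> e eu; rewrite inE => ne; apply: XedgeP => Xe; move/eqP: ne; apply.
by apply: (wuniq s) => //; rewrite ?su ?eu.
Qed.

End SocleStep.

(** * Chen modules *)

Section InfinitePaths.
Variable E : digraph.
Implicit Types (p q : nat -> edge E) (s t : seq (edge E)).

Definition valid q : Prop := forall n, erange (q n) = esource (q n.+1).
Definition icons e q : nat -> edge E := fun n => if n is m.+1 then q m else e.
Definition idrop m q : nat -> edge E := fun n => q (m + n)%N.
Definition icat s q : nat -> edge E := foldr icons q s.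

Lemma icons_inj e q p : p = icons e q <-> p 0%N = e /\ idrop 1 p = q.
Proof.
split=> [->|[<- <-]]; first by split=> //; apply/funext.
by apply/funext=> -[].
Qed.

Lemma valid_icons e q : valid (icons e q) <-> erange e = esource (q 0%N) /\ valid q.
Proof.
split=> [h|[h v] [|n] //=].
by split; [exact: (h 0%N)|move=> n; exact: (h n.+1)].
Qed.

Lemma valid_idrop m q : valid q -> valid (idrop m q).
Proof. by move=> v n; rewrite /idrop v addnS. Qed.

Lemma idropD m n q : idrop m (idrop n q) = idrop (n + m) q.
Proof. by apply/funext => i; rewrite /idrop addnA. Qed.

Lemma icat_at s q e0 i : icat s q i = if (i < size s)%N then nth e0 s i else q (i - size s)%N.
Proof.
elim: s i => [|e s IH] i /=; first by rewrite subn0.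
by case: i => //= i; rewrite IH.
Qed.

Lemma icat_mkseq m q : icat (mkseq q m) (idrop m q) = q.
Proof.
apply/funext => i; rewrite (icat_at _ _ (q 0%N)) size_mkseq; case: ltnP => im.
  by rewrite nth_mkseq.
by rewrite /idrop subnKC.
Qed.

Lemma icat_inj s p q : icat s p = icat s q -> p = q.
Proof.
elim: s => //= e s IH h; apply: IH; apply/funext => i.
by have := congr1 (fun f => f i.+1) h.
Qed.

Lemma vpath_mkseq m q : valid q -> vpath (esource (q 0%N)) (mkseq q m) (esource (q m)).
Proof.
move=> v; elim: m => [|m IH]; first by rewrite /= eqxx.
rewrite mkseqS -cats1; apply/vpath_cat; exists (esource (q m)) => //=.
by rewrite v !eqxx.
Qed.

Lemma valid_icat u s q : vpath u s (esource (q 0%N)) -> valid q -> valid (icat s q).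
Proof.
elim: s u => //= e s IH u /andP[_ h] v; apply/valid_icons; split; last exact: IH h v.
by case: s h {IH} => [/eqP ->|f s /andP[/eqP -> _]].
Qed.

End InfinitePaths.

Section Action.
Variables (E : digraph) (K F : fieldType) (iota : {rmorphism K -> F}).
Variable wt : edge E -> F.
Hypothesis wt0 : forall e, wt e != 0.
Local Notation L := (lpa E K).
Local Notation ipath := (nat -> edge E).
Implicit Types (p q : ipath) (phi psi : ipath -> F) (s t : seq (edge E)).

(* The action on all functions; the Chen module of an infinite path is the submodule
   generated by its indicator function. The sequences which are not paths only
   carry the value 0 after any action. *)
Fixpoint term_act (a : lpa_term E K) phi : ipath -> F :=
  match a with
  | tvertex v => fun q => if `[< valid q /\ esource (q 0%N) = v >] then phi q else 0
  | tedge e => fun q => if `[< valid q /\ q 0%N = e >] then wt e * phi (idrop 1 q) else 0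
  | tghost e => fun q =>
      if `[< valid (icons e q) >] then (wt e)^-1 * phi (icons e q) else 0
  | tzero => fun=> 0
  | tadd a b => fun q => term_act a phi q + term_act b phi q
  | topp a => fun q => - term_act a phi q
  | tscale k a => fun q => iota k * term_act a phi q
  | tmul a b => term_act a (term_act b phi)
  end.

Lemma term_actD a phi psi : term_act a (fun q => phi q + psi q) =
  fun q => term_act a phi q + term_act a psi q.
Proof.
elim: a phi psi => //=.
- by move=> v phi psi; apply/funext => q; case: asboolP; rewrite ?addr0.
- by move=> e phi psi; apply/funext => q; case: asboolP; rewrite ?addr0 ?mulrDr.
- by move=> e phi psi; apply/funext => q; case: asboolP; rewrite ?addr0 ?mulrDr.
- by move=> phi psi; apply/funext => q; rewrite addr0.
- by move=> a IHa b IHb phi psi; apply/funext => q; rewrite IHa IHb addrACA.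
- by move=> a IHa phi psi; apply/funext => q; rewrite IHa opprD.
- by move=> k a IHa phi psi; apply/funext => q; rewrite IHa mulrDr.
- by move=> a IHa b IHb phi psi; rewrite IHb IHa.
Qed.

Lemma term_actZ a k phi : term_act a (fun q => k * phi q) =
  fun q => k * term_act a phi q.
Proof.
elim: a phi => //=.
- by move=> v phi; apply/funext => q; case: asboolP; rewrite ?mulr0.
- by move=> e phi; apply/funext => q; case: asboolP => _; [exact: mulrCA|rewrite mulr0].
- by move=> e phi; apply/funext => q; case: asboolP => _; [exact: mulrCA|rewrite mulr0].
- by move=> phi; apply/funext => q; rewrite mulr0.
- by move=> a IHa b IHb phi; apply/funext => q; rewrite IHa IHb mulrDr.
- by move=> a IHa phi; apply/funext => q; rewrite IHa mulrN.
- by move=> c a IHa phi; apply/funext => q; rewrite IHa mulrCA.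
- by move=> a IHa b IHb phi; rewrite IHb IHa.
Qed.

Lemma term_act_edge_ghost e phi q : term_act (tmul (tedge K e) (tghost K e)) phi q =
  if `[< valid q /\ q 0%N = e >] then phi q else 0.
Proof.
move=> /=; case: asboolP => [[v qe]|//].
have -> : icons e (idrop 1 q) = q by symmetry; apply/icons_inj.
by case: asboolP => // _; rewrite mulrA mulfV ?mul1r.
Qed.

Let ck_sum (es : seq (edge E)) : lpa_term E K :=
  foldr (fun e b => tadd (tmul (tedge K e) (tghost K e)) b) (tzero E K) es.

(** Each e e^* acts as restriction to the paths starting with e, and an infinite path starts with
    exactly one edge. *)
Lemma term_act_CK2 (es : seq (edge E)) phi q : List.NoDup es ->
  term_act (ck_sum es) phi q = if `[< valid q /\ List.In (q 0%N) es >] then phi q else 0.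
Proof.
elim: es => [_|e es IH /List.NoDup_cons_iff[nin nd]].
  by rewrite /=; case: asboolP => // -[].
have -> : term_act (ck_sum (e :: es)) phi q =
  term_act (tmul (tedge K e) (tghost K e)) phi q + term_act (ck_sum es) phi q by [].
rewrite term_act_edge_ghost IH //=.
case: asboolP => [[v qe]|n1].
  case: asboolP => [[_ qes]|n2]; first by case: nin; rewrite -qe.
  by rewrite addr0; case: asboolP => // -[]; split=> //; left.
rewrite add0r; case: asboolP => [[v qes]|n2]; case: asboolP => // n3.
  by case: n3; split=> //; right.
by have [v [h|h]] := n3; [case: n1|case: n2].
Qed.

Lemma term_act_eq a b phi : lpa_eq a b -> term_act a phi = term_act b phi.
Proof.
move=> h; elim: h phi => {a b} //=.
- by move=> a b c _ IH _ IH' phi; rewrite IH IH'.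
- by move=> a a' b b' _ IHa _ IHb phi; apply/funext => q; rewrite IHa IHb.
- by move=> a a' _ IHa phi; apply/funext => q; rewrite IHa.
- by move=> k a a' _ IHa phi; apply/funext => q; rewrite IHa.
- by move=> a a' b b' _ IHa _ IHb phi; rewrite IHa IHb.
- by move=> a b c phi; apply/funext => q; rewrite addrA.
- by move=> a b phi; apply/funext => q; rewrite addrC.
- by move=> a phi; apply/funext => q; rewrite add0r.
- by move=> a phi; apply/funext => q; rewrite addNr.
- by move=> c d a phi; apply/funext => q; rewrite rmorphM mulrA.
- by move=> a phi; apply/funext => q; rewrite rmorph1 mul1r.
- by move=> c a b phi; apply/funext => q; rewrite mulrDr.
- by move=> c d a phi; apply/funext => q; rewrite rmorphD mulrDl.
- by move=> a b c phi; rewrite term_actD.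
- by move=> c a b phi; rewrite term_actZ.
- by move=> v phi; apply/funext => q; case: asboolP.
- move=> v w vw phi; apply/funext => q; case: asboolP => // -[_ e].
  by case: asboolP => // -[_ e']; case: vw; rewrite -e -e'.
- move=> e phi; apply/funext => q; case: asboolP => // nv; case: asboolP => // -[v qe].
  by case: nv; rewrite qe.
- move=> e phi; apply/funext => q; case: asboolP => // -[v qe].
  case: asboolP => // -[]; split; first exact: valid_idrop.
  by rewrite /idrop -v qe.
- move=> e phi; apply/funext => q; case: asboolP => // nv; case: asboolP => // v.
  by case: nv; have /valid_icons[] := v.
- by move=> e phi; apply/funext => q; case: asboolP => // v; case: asboolP => // -[].
- move=> e phi; apply/funext => q; case: asboolP => [v|nv].
    case: asboolP => [_|[]//]; rewrite mulrA mulVf // mul1r.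
    have /valid_icons[-> vq] := v; case: asboolP => [_|[]//].
    by congr phi; apply/funext.
  case: asboolP => // -[vq sq]; case: nv; exact/valid_icons.
- move=> e f ef phi; apply/funext => q; case: asboolP => // v.
  by case: asboolP => [[_ /= /esym]//|_]; rewrite mulr0.
- move=> v es es0 nd hes phi; apply/funext => q; rewrite term_act_CK2 //.
  case: asboolP => [[vq /hes h]|n1]; case: asboolP => // -[]; first by [].
  by move=> vq /hes h; case: n1.
Qed.

Definition act (x : L) phi : ipath -> F := term_act (repr x) phi.

Lemma act_class a phi : act (lpa_class a) phi = term_act a phi.
Proof. exact/term_act_eq/lpa_repr_class. Qed.

Lemma actM (x y : L) phi : act (x ** y) phi = act x (act y phi).
Proof. by rewrite -{1}(lpa_reprK x) -{1}(lpa_reprK y) -lpa_classM act_class. Qed.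

Lemma actD (x y : L) phi q : act (x + y) phi q = act x phi q + act y phi q.
Proof. by rewrite -{1}(lpa_reprK x) -{1}(lpa_reprK y) -lpa_classD act_class. Qed.

Lemma actN (x : L) phi q : act (- x) phi q = - act x phi q.
Proof. by rewrite -{1}(lpa_reprK x) -lpa_classN act_class. Qed.

Lemma actB (x y : L) phi q : act (x - y) phi q = act x phi q - act y phi q.
Proof. by rewrite actD actN. Qed.

Lemma actZ k (x : L) phi q : act (k *: x) phi q = iota k * act x phi q.
Proof. by rewrite -{1}(lpa_reprK x) -lpa_classZ act_class. Qed.

Lemma act0 phi q : act 0 phi q = 0.
Proof. by rewrite -lpa_class0 act_class. Qed.

Lemma act_scale (x : L) k phi : act x (fun q => k * phi q) = fun q => k * act x phi q.
Proof. exact: term_actZ. Qed.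

Lemma act_fun0 (x : L) : act x (fun=> 0) = fun=> 0.
Proof.
have -> : (fun=> 0) = (fun q : ipath => (0 : F) * 0) by apply/funext => q; rewrite mul0r.
by rewrite act_scale; apply/funext => q; rewrite !mul0r.
Qed.

Lemma act_vert v phi q :
  act (lvert K v) phi q = if `[< valid q /\ esource (q 0%N) = v >] then phi q else 0.
Proof. by rewrite act_class. Qed.

Lemma act_edge e phi q : act (ledge K e) phi q =
  if `[< valid q /\ q 0%N = e >] then wt e * phi (idrop 1 q) else 0.
Proof. by rewrite act_class. Qed.

Lemma act_ghost e phi q : act (lghost K e) phi q =
  if `[< valid (icons e q) >] then (wt e)^-1 * phi (icons e q) else 0.
Proof. by rewrite act_class. Qed.

Definition pathwt s : F := \prod_(e <- s) wt e.

Lemma pathwt_neq0 s : pathwt s != 0.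
Proof. rewrite /pathwt prodf_seq_neq0; apply/allP => e _; exact: wt0. Qed.

Lemma act_copath s w phi q : act (lcopath K s w) phi q =
  if `[< valid (icat s q) /\ esource (q 0%N) = w >]
  then (pathwt s)^-1 * phi (icat s q) else 0.
Proof.
elim: s phi => [|e s IH] phi /=.
  by rewrite act_vert /pathwt big_nil invr1 mul1r.
rewrite actM IH act_ghost /pathwt big_cons invfM.
case: asboolP => [[v qw]|n1].
  case: asboolP => [v'|n2]; first by case: asboolP => [_|[]//]; rewrite mulrA (mulrC (wt e)^-1).
  by rewrite mulr0; case: asboolP => // -[].
by case: asboolP => // -[/valid_icons[_ v] qw]; case: n1.
Qed.

Lemma act_path s w phi q : valid (icat s q) -> esource (q 0%N) = w ->
  act (lpath K s w) phi (icat s q) = pathwt s * phi q.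
Proof.
elim: s => [|e s IH] /= v qw.
  by rewrite act_vert /pathwt big_nil mul1r; case: asboolP => // -[].
have /valid_icons[_ v'] := v.
rewrite actM act_edge; case: asboolP => [_|[]//].
have -> : idrop 1 (icons e (icat s q)) = icat s q by apply/funext.
by rewrite IH // /pathwt big_cons mulrA.
Qed.

Definition delta p (k : F) : ipath -> F := fun q => if `[< q = p >] then k else 0.

Lemma deltaE p k : delta p k p = k.
Proof. by rewrite /delta; case: asboolP. Qed.

Lemma delta_scale p k c : delta p (c * k) = fun q => c * delta p k q.
Proof. by apply/funext => q; rewrite /delta; case: asboolP; rewrite ?mulr0. Qed.

Lemma delta_scale1 p k : delta p k = fun q => k * delta p 1 q.
Proof. by rewrite -delta_scale mulr1. Qed.

Lemma act_vert_delta p k : valid p -> act (lvert K (esource (p 0%N))) (delta p k) = delta p k.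
Proof.
move=> v; apply/funext => q; rewrite act_vert /delta; case: asboolP => // nq.
by case: asboolP => // qp; case: nq; rewrite qp.
Qed.

Lemma act_edge_delta e p k : valid p -> erange e = esource (p 0%N) ->
  act (ledge K e) (delta p k) = delta (icons e p) (wt e * k).
Proof.
move=> v ep; apply/funext => q; rewrite act_edge /delta.
have vp : valid (icons e p) by exact/valid_icons.
case: asboolP => [[vq qe]|nq].
  case: asboolP => [qp|nqp]; case: asboolP => [qq|nqq]; rewrite ?mulr0 //.
    by case: nqq; apply/icons_inj.
  by case: nqp; move/icons_inj: qq => [].
by case: asboolP => // qp; case: nq; rewrite qp.
Qed.

Lemma act_path_delta s u p k : valid p -> vpath u s (esource (p 0%N)) ->
  act (lpath K s (esource (p 0%N))) (delta p k) = delta (icat s p) (pathwt s * k).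
Proof.
move=> v; elim: s u => [|e s IH] u /= h.
  by rewrite act_vert_delta // /pathwt big_nil mul1r.
have /andP[_ h'] := h.
have /valid_icons[er vs] : valid (icat (e :: s) p).
  by apply: (@valid_icat _ u (e :: s)).
by rewrite actM (IH _ h') act_edge_delta // /pathwt big_cons mulrA.
Qed.

Definition tail_eq p q : Prop := exists m n, idrop m p = idrop n q.

(** These functions form the Chen module of the tail class of [p], with scalars in [F]. *)
Definition fin_supp p phi : Prop :=
  (exists Q : seq ipath, forall q, phi q <> 0 -> List.In q Q) /\
  forall q, phi q <> 0 -> valid q /\ tail_eq q p.

Lemma fin_supp_delta p k : valid p -> fin_supp p (delta p k).
Proof.
move=> v; split.
  by exists [:: p] => q; rewrite /delta; case: asboolP => // -> _; left.
move=> q; rewrite /delta; case: asboolP => // -> _; split=> //.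
by exists 0%N, 0%N.
Qed.

Lemma fin_supp_act p (x : L) phi : fin_supp p phi -> fin_supp p (act x phi).
Proof.
elim/lpa_elim: x phi.
- move=> v phi [[Q hQ] hphi]; split.
    by exists Q => q; rewrite act_vert; case: asboolP => // _; exact: hQ.
  by move=> q; rewrite act_vert; case: asboolP => // _; exact: hphi.
- move=> e phi [[Q hQ] hphi].
  have h q : act (ledge K e) phi q <> 0 -> [/\ valid q, q 0%N = e & phi (idrop 1 q) <> 0].
    rewrite act_edge; case: asboolP => // -[v qe] ne; split=> // e0; apply: ne.
    by rewrite e0 mulr0.
  split.
    exists (map (icons e) Q) => q /h[v qe /hQ qQ]; apply/List.in_map_iff.
    by exists (idrop 1 q); split=> //; symmetry; apply/icons_inj.
  move=> q /h[v qe /hphi[_ [m [n mn]]]]; split=> //; exists (1 + m)%N, n.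
  by rewrite -idropD.
- move=> e phi [[Q hQ] hphi].
  have h q : act (lghost K e) phi q <> 0 -> valid q /\ phi (icons e q) <> 0.
    rewrite act_ghost; case: asboolP => // /valid_icons[_ v] ne; split=> // e0; apply: ne.
    by rewrite e0 mulr0.
  split.
    exists (map (idrop 1) Q) => q /h[v /hQ qQ]; apply/List.in_map_iff.
    by exists (icons e q); split=> //; apply/funext.
  move=> q /h[v /hphi[_ [m [n mn]]]]; split=> //; exists m, (n + 1)%N.
  by rewrite -idropD -mn; apply/funext => i; rewrite /idrop addnA addn1.
- move=> phi [[Q hQ] hphi]; split; first by exists Q => q; rewrite act0.
  by move=> q; rewrite act0.
- move=> x y IHx IHy phi hphi.
  have [[Q hQ] hx] := IHx _ hphi; have [[Q' hQ'] hy] := IHy _ hphi.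
  have h q : act (x + y) phi q <> 0 -> act x phi q <> 0 \/ act y phi q <> 0.
    rewrite actD; have [->|nx] := eqVneq (act x phi q) 0; last by left; exact/eqP.
    by rewrite add0r; right.
  split; last by move=> q /h[/hx|/hy].
  by exists (Q ++ Q') => q /h[/hQ|/hQ'] h'; apply/List.in_or_app; [left|right].
- move=> x IHx phi hphi; have [[Q hQ] hx] := IHx _ hphi.
  have h q : act (- x) phi q <> 0 -> act x phi q <> 0.
    by rewrite actN => ne e0; apply: ne; rewrite e0 oppr0.
  by split; [exists Q => q /h /hQ|move=> q /h /hx].
- move=> k x IHx phi hphi; have [[Q hQ] hx] := IHx _ hphi.
  have h q : act (k *: x) phi q <> 0 -> act x phi q <> 0.
    by rewrite actZ => ne e0; apply: ne; rewrite e0 mulr0.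
  by split; [exists Q => q /h /hQ|move=> q /h /hx].
- by move=> x y IHx IHy phi hphi; rewrite actM; apply: IHx; exact: IHy.
Qed.

Lemma separate (Q : seq ipath) q1 : exists N, forall q, List.In q Q ->
  mkseq q N = mkseq q1 N -> q = q1.
Proof.
elim: Q => [|q Q [N hN]]; first by exists 0%N.
have mono m n q' : (m <= n)%N -> mkseq q' n = mkseq q1 n -> mkseq q' m = mkseq q1 m.
  by move=> mn /(congr1 (take m)); rewrite -!map_take take_iota (minn_idPl mn).
have [[i ne]|alleq] := pselect (exists i, q i <> q1 i).
  exists (maxn N i.+1) => q' /= [<- h|/hN + h].
    have := congr1 (fun s => nth (q i) s i) (mono i.+1 _ _ (leq_maxr _ _) h).
    by rewrite /= !nth_mkseq.
  by apply; apply: mono h; exact: leq_maxl.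
exists N => q' /= [<- _|/hN //]; apply/funext => i; apply: contrapT => ne.
by apply: alleq; exists i.
Qed.

(** The ghost of a long initial segment of [q1] kills every other path of the support and leaves a
    tail of [q1]; prepending an initial segment of [p] to this tail gives [p]. *)
Lemma fin_supp_to_delta p phi q1 : valid p -> fin_supp p phi -> phi q1 <> 0 ->
  exists (b : L) k, k != 0 /\ act b phi = delta p k.
Proof.
move=> vp [[Q hQ] hphi] nq1; have [vq1 [m [n mn]]] := hphi _ nq1.
(* [M] exceeds [m], to reach the tail shared with [p], by [N], to tell [q1] from the rest of [Q]. *)
have [N hN] := separate Q q1; set M := (m + N)%N.
have MN : idrop M q1 = idrop (n + N) p by rewrite /M -!idropD mn.
pose s := mkseq q1 M; pose w := esource (q1 M).
have wE : w = esource (p (n + N)%N).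
  by rewrite /w; have := congr1 (fun f => f 0%N) MN; rewrite /idrop !addn0 => ->.
have e1 : act (lcopath K s w) phi = delta (idrop M q1) ((pathwt s)^-1 * phi q1).
  apply/funext => q; rewrite act_copath /delta.
  have icq : icat s q = q1 -> q = idrop M q1.
    by move=> h; apply: (@icat_inj _ s); rewrite h icat_mkseq.
  case: asboolP => [[v qw]|nv]; case: asboolP => [qq|nqq] //.
  - by rewrite qq icat_mkseq.
  - have [->|ne] := eqVneq (phi (icat s q)) 0; first by rewrite mulr0.
    case: nqq; apply: icq; apply: hN; first by apply: hQ; exact/eqP.
    apply/(@eq_from_nth _ (q1 0%N)); rewrite !size_mkseq // => i iN.
    rewrite !nth_mkseq // (icat_at _ _ (q1 0%N)) size_mkseq.
    have iM : (i < M)%N by rewrite (leq_trans iN) // leq_addl.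
    by rewrite iM nth_mkseq.
  - by case: nv; rewrite qq icat_mkseq; split=> //; rewrite /idrop addn0.
pose t := mkseq p (n + N).
have v2 : valid (idrop (n + N) p) by exact: valid_idrop.
have src : esource (idrop (n + N) p 0%N) = w by rewrite wE /idrop addn0.
exists (lpath K t w ** lcopath K s w), (pathwt t * ((pathwt s)^-1 * phi q1)).
split; first by rewrite !mulf_neq0 ?invr_neq0 ?pathwt_neq0 //; exact/eqP.
rewrite actM e1 MN -src (act_path_delta (u := esource (p 0%N))) ?icat_mkseq //.
by rewrite src wE; exact: vpath_mkseq.
Qed.

Definition delta_ann p : set L := [set a | act a (delta p 1) = fun=> 0].

Lemma delta_ann_submod p : @is_submodule L (regular_mod L) (delta_ann p).
Proof.
split=> [|x y hx hy|a x hx]; rewrite /delta_ann /=.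
- by apply/funext => q; rewrite act0.
- by apply/funext => q; rewrite actB hx hy subrr.
- by rewrite actM hx act_fun0.
Qed.

Lemma delta_ann_vert p : valid p -> ~ delta_ann p (lvert K (esource (p 0%N))).
Proof.
move=> v; rewrite /delta_ann /= act_vert_delta // => /(congr1 (fun f => f p)).
by rewrite deltaE => /eqP; rewrite oner_eq0.
Qed.

(** Any nonzero multiple of the indicator of [p] can be turned into [k] times that indicator with
    [k] nonzero. As [k] is in [F] and the algebra has scalars in [K], dividing by [k] needs the
    second hypothesis. *)
Lemma delta_ann_maximal p : valid p ->
  (forall k, exists b : L, act b (delta p 1) = delta p k) ->
  @modular_maximal L (delta_ann p).
Proof.
move=> v hk; set u := lvert K (esource (p 0%N)).
have uu : forall a : L, delta_ann p (a - a ** u).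
  by move=> a; apply/funext => q; rewrite actB actM act_vert_delta // subrr.
split; first exact: delta_ann_submod.
  by exists u; split=> //; exact: delta_ann_vert.
move=> N' hN' sub; have [[x [N'x nx]]|h] := pselect (exists x : L, N' x /\ ~ delta_ann p x).
  right; apply/seteqP; split=> // a _.
  apply: (submod_subl hN' (y := a ** u)); first exact: sub.
  apply: (submodM hN' a).
  have [q1 nq1] : exists q1, act x (delta p 1) q1 <> 0.
    apply: contrapT => h; apply: nx; apply/funext => q.
    by apply: contrapT => hq; apply: h; exists q.
  have fs := fin_supp_act x (fin_supp_delta 1 v).
  have [b [k [k0 eb]]] := fin_supp_to_delta v fs nq1.
  have [c ec] := hk k^-1.
  have ecbx : act (c ** b ** x) (delta p 1) = delta p 1.
    rewrite !actM eb delta_scale1 act_scale ec -delta_scale.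
    by rewrite mulfV.
  have : N' (u - c ** b ** x).
    apply: sub; apply/funext => q.
    by rewrite actB ecbx act_vert_delta // subrr.
  move/(submod_subl hN'); apply; exact: (submodM hN').
left; apply/seteqP; split=> // x N'x; apply: contrapT => nx; apply: h.
by exists x.
Qed.

End Action.

Section Comparison.
Variables (E : digraph) (K F F' : fieldType).
Variables (iota : {rmorphism K -> F}) (iota' : {rmorphism K -> F'}).
Variables (wt : edge E -> F) (wt' : edge E -> F').
Hypothesis wt0 : forall e, wt e != 0.
Hypothesis wt0' : forall e, wt' e != 0.
Local Notation L := (lpa E K).

(* An element of the second module with the same annihilator as the indicator of [p]
   is supported at [p]: another path [q] of its support has an initial segment [s]
   with [s s^*] killing the indicator of [p] but not that element. *)
Lemma delta_ann_compare (p p' : nat -> edge E) (b : L) : valid p -> valid p' ->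
  (forall a : L, delta_ann iota wt p a <-> delta_ann iota' wt' p' (a ** b)) ->
  tail_eq p p' /\ exists2 k, k != 0 & act iota' wt' b (delta p' 1) = delta p k.
Proof.
move=> v v' h; set phi := act iota' wt' b (delta p' 1).
have fs : fin_supp p' phi by apply: fin_supp_act => //; exact: fin_supp_delta.
have [q1 nq1] : exists q, phi q <> 0.
  apply: contrapT => nq; apply: (delta_ann_vert (iota := iota) wt0 v); apply/h.
  rewrite /delta_ann /= actM // -/phi.
  have -> : phi = fun=> 0.
    by apply/funext => q; apply: contrapT => hq; apply: nq; exists q.
  exact: act_fun0.
have supp q : phi q <> 0 -> q = p.
  move=> nq; apply/funext => i; apply: contrapT => ne.
  have [vq _] := fs.2 _ nq.
  pose s := mkseq q i.+1; pose w := esource (q i.+1).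
  have /h : delta_ann iota wt p (lpath K s w ** lcopath K s w).
    rewrite /delta_ann /= actM //.
    have -> : act iota wt (lcopath K s w) (delta p 1) = fun=> 0.
      apply/funext => r; rewrite act_copath // /delta; case: asboolP => // _.
      case: asboolP => [rp|_]; last by rewrite mulr0.
      case: ne; rewrite -rp (icat_at _ _ (q 0%N)) size_mkseq ltnSn.
      by rewrite nth_mkseq.
    exact: act_fun0.
  rewrite /delta_ann /= actM // actM // -/phi => /(congr1 (fun f => f q)).
  have qE : icat s (idrop i.+1 q) = q by exact: icat_mkseq.
  have sq : esource (idrop i.+1 q 0%N) = w by rewrite /idrop addn0.
  have vs : valid (icat s (idrop i.+1 q)) by rewrite qE.
  have := act_path iota' wt0' (act iota' wt' (lcopath K s w) phi) vs sq.
  rewrite qE act_copath // qE sq.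
  case: asboolP => [_|[]//]; rewrite mulrA mulfV ?pathwt_neq0 // mul1r.
  by move=> e1 e2; apply: nq; rewrite -e1.
have q1p := supp _ nq1; rewrite q1p in nq1.
split; first by case: fs => _ /(_ _ nq1)[].
exists (phi p); first exact/eqP.
apply/funext => q; rewrite /delta; case: asboolP => [->//|nq].
by apply: contrapT => /supp.
Qed.

End Comparison.

(** * Closed paths and branching *)

Section ClosedPaths.
Variable E : digraph.
Implicit Types (u v w : vertex E) (e : edge E) (s c : seq (edge E)).

Lemma vpath_nth u s w (e0 : edge E) i : vpath u s w -> (i.+1 < size s)%N ->
  erange (nth e0 s i) = esource (nth e0 s i.+1).
Proof.
elim: s u i => //= e [//|f s] IH u [|i] /andP[_ h] //= si.
  by have /andP[/eqP <- _] := h.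
exact: (IH _ i h).
Qed.

Lemma vpath_last u e s w (e0 : edge E) : vpath u (e :: s) w -> erange (last e0 (e :: s)) = w.
Proof.
elim: s u e => [|f s IH] u e /= /andP[_ h]; first exact/eqP.
exact: IH h.
Qed.

(** If the first edge recurs, the part before its recurrence is a shorter closed path. *)
Lemma shortest_closed_path : ~ acyclic E ->
  exists e c, vpath (esource e) (e :: c) (esource e) /\ e \notin c.
Proof.
move=> nac; have [v [s [hs s0]]] : exists v s, vpath (E := E) v s v /\ s <> [::].
  apply: contrapT => h; apply: nac => v s hs; apply: contrapT => s0; apply: h.
  by exists v, s.
have [n] := ubnP (size s); elim: n v s hs s0 => // n IH v [//|e s] hs _ sz.
have /andP[/eqP ev h] := hs.
have [es|es] := boolP (e \in s); last first.
  by exists e, s; split=> //; rewrite ev.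
case/splitPr: es h sz => p1 p2 /vpath_cat[w h1 /andP[/eqP ew _]] sz.
apply: (IH (esource e) (e :: p1)) => //=; first by rewrite eqxx ew.
by move: sz; rewrite /= size_cat /= !ltnS addnS; apply: leq_trans; rewrite ltnS leq_addr.
Qed.

Definition cycle_path (e : edge E) (c : seq (edge E)) : nat -> edge E :=
  fun n => nth e (e :: c) (n %% size (e :: c)).

Lemma icat_cycle_path e c : icat (e :: c) (cycle_path e c) = cycle_path e c.
Proof.
apply/funext => i; rewrite (icat_at _ _ e) /cycle_path; case: ltnP => h.
  by rewrite modn_small.
by congr nth; rewrite -[in RHS](subnK h) modnDr.
Qed.

Lemma valid_cycle_path e c : vpath (esource e) (e :: c) (esource e) ->
  valid (cycle_path e c).
Proof.
move=> h n; rewrite /cycle_path; set s := e :: c.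
have lt : (n %% size s < size s)%N by rewrite ltn_mod.
rewrite -(addn1 n) -modnDml addn1.
have [lt1|ge1] := ltnP (n %% size s).+1 (size s).
  by rewrite [in RHS](modn_small lt1) (vpath_nth _ h lt1).
have -> : (n %% size s).+1 = size s by apply/eqP; rewrite eqn_leq lt.
rewrite modnn /= -(vpath_last e h); congr erange.
have -> : (n %% size s = (size s).-1)%N.
  by apply/eqP; rewrite -eqSS prednK // eqn_leq lt.
exact: nth_last.
Qed.

End ClosedPaths.

Lemma irreducible_factor (K : fieldType) (g : {poly K}) : (1 < size g)%N ->
  exists2 f, irreducible_poly f & f %| g.
Proof.
have [n] := ubnP (size g); elim: n g => // n IH g sz g1.
have [irr|nirr] := pselect (irreducible_poly g); first by exists g.
have [q [q1 qg nqg]] : exists q : {poly K}, [/\ size q != 1%N, q %| g & ~~ (q %= g)].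
  apply: contrapT => h; apply: nirr; split=> // q q1 qg.
  by apply: contrapT => /negP nqg; apply: h; exists q.
have g0 : g != 0 by rewrite -size_poly_gt0 ltnW.
have q0 : q != 0 by apply: contraTneq qg => ->; rewrite dvd0p.
have szq : (size q < size g)%N.
  rewrite ltn_neqAle dvdp_leq // andbT.
  by apply: contraNneq nqg => e; rewrite -dvdp_size_eqp // e.
have [|f irrf fq] := IH q (leq_trans szq sz).
  by rewrite ltn_neqAle eq_sym q1 size_poly_gt0.
by exists f => //; exact: dvdp_trans fq qg.
Qed.

(** * Twists of the module of a closed path *)

Section TwistedModules.
Variables (E : digraph) (K : fieldType) (e0 : edge E) (c : seq (edge E)).
Hypothesis hc : vpath (esource e0) (e0 :: c) (esource e0).
Hypothesis e0c : e0 \notin c.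
Local Notation L := (lpa E K).

Let p := cycle_path e0 c.
Let v := esource e0.
Let C : L := lpath K (e0 :: c) v.

Let pv : valid p. Proof. exact: valid_cycle_path. Qed.

(** The value of [h] at the closed path [C] in the corner v L v, whose unit is [v]. *)
Definition poly_elt (h : {poly K}) : L :=
  \sum_(i < size h) h`_i *: iter i (fun x => C ** x) (lvert K v).

Section OneField.
Variables (F : fieldType) (iota : {rmorphism K -> F}) (alpha : F).
Hypothesis alpha0 : alpha != 0.

(* As [e0] occurs exactly once in the closed path, the closed path acts on its own
   infinite power by [alpha]. *)
Definition cycle_wt (e : edge E) : F := if e == e0 then alpha else 1.

Lemma cycle_wt_neq0 e : cycle_wt e != 0.
Proof. by rewrite /cycle_wt; case: ifP => _ //; exact: oner_neq0. Qed.

Let wt0 := cycle_wt_neq0.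

Lemma pathwt_cycle : pathwt cycle_wt (e0 :: c) = alpha.
Proof.
rewrite /pathwt big_cons /cycle_wt eqxx big1_seq ?mulr1 // => e /andP[_ ec].
by case: eqP => // ee; case/negP: e0c; rewrite -ee.
Qed.

Lemma act_cycle k : act iota cycle_wt C (delta p k) = delta p (alpha * k).
Proof.
have := act_path_delta iota wt0 (s := e0 :: c) (u := v) k pv.
by rewrite icat_cycle_path pathwt_cycle; apply; rewrite -/v.
Qed.

Lemma act_poly_elt h k : act iota cycle_wt (poly_elt h) (delta p k) =
  delta p ((map_poly iota h).[alpha] * k).
Proof.
have hiter i : act iota cycle_wt (iter i (fun x => C ** x) (lvert K v)) (delta p k) =
    delta p (alpha ^+ i * k).
  elim: i => [|i IH]; first by rewrite expr0 mul1r act_vert_delta.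
  by rewrite iterS actM // IH act_cycle exprS mulrA.
rewrite (horner_coef_wide _ (size_poly _ _)) /poly_elt; apply/funext => q.
rewrite (big_morph (fun x => act iota cycle_wt x (delta p k) q)
  (id1 := 0) (op1 := +%R)); last 2 first.
- by move=> x y; exact: actD.
- exact: act0.
rewrite mulr_suml [RHS]/delta; case: asboolP => [->|nq].
  apply: eq_bigr => i _; rewrite actZ // hiter deltaE coef_map mulrA //.
by apply: big1 => i _; rewrite actZ // hiter /delta; case: asboolP; rewrite ?mulr0.
Qed.

Lemma cycle_ann_maximal : (forall k, exists h : {poly K}, (map_poly iota h).[alpha] = k) ->
  modular_maximal (delta_ann iota cycle_wt p).
Proof.
move=> hk; apply: delta_ann_maximal => // k; have [h <-] := hk k.
by exists (poly_elt h); rewrite act_poly_elt mulr1.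
Qed.

End OneField.

(** The annihilator knows the roots: h(C) multiplies the indicator of [p] by h(alpha), and by
    [delta_ann_compare] the element [b] only rescales that indicator. *)
Lemma cycle_ann_root (F F' : fieldType) (iota : {rmorphism K -> F})
    (iota' : {rmorphism K -> F'}) alpha alpha' (b : L) (h : {poly K}) :
  alpha != 0 -> alpha' != 0 ->
  (forall a : L, delta_ann iota (cycle_wt alpha) p a <->
     delta_ann iota' (cycle_wt alpha') p (a ** b)) ->
  (map_poly iota h).[alpha] = 0 -> (map_poly iota' h).[alpha'] = 0.
Proof.
move=> a0 a0' hb rh.
have wt0 := cycle_wt_neq0 a0; have wt0' := cycle_wt_neq0 a0'.
have [_ [k k0 ek]] := delta_ann_compare wt0 wt0' pv pv hb.
have /hb : delta_ann iota (cycle_wt alpha) p (poly_elt h).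
  rewrite /delta_ann /= act_poly_elt // rh mul0r.
  by apply/funext => q; rewrite /delta; case: asboolP.
rewrite /delta_ann /= actM // ek act_poly_elt // => /(congr1 (fun f => f p)).
by rewrite deltaE => /eqP; rewrite mulf_eq0 (negbTE k0) orbF => /eqP.
Qed.

End TwistedModules.

(* Euclid's argument: with [f i] an irreducible polynomial realized in the i-th class,
   an irreducible factor of [(\prod_i f i) * 'X + 1] is realized in no class. *)
Lemma acyclic_of_finitely_many (E : digraph) (K : fieldType) :
  finitely_many_simple_left_modules (lpa E K) -> acyclic E.
Proof.
move=> /finitely_many_classes[n [cl [clN clI]]]; apply: contrapT.
move=> /shortest_closed_path[e [c [hc ec]]].
pose N (F : fieldExtType K) (al : F) := delta_ann (in_alg F) (cycle_wt e al) (cycle_path e c).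
pose Q (i : 'I_n) (f : {poly K}) := f != 0 /\ exists (F : fieldExtType K) (al : F),
  [/\ al != 0, root (map_poly (in_alg F) f) al, modular_maximal (N F al) & cl (N F al) i].
(* A class in which no polynomial is realized gets 1, which does not affect the product. *)
have /choice[f hf] i : exists f : {poly K}, f != 0 /\ ((exists g, Q i g) -> Q i f).
  have [[g Qg]|nQ] := pselect (exists g, Q i g); first by exists g; split=> //; case: Qg.
  by exists 1; split=> //; exact: oner_neq0.
pose G := (\prod_i f i) * 'X + 1%:P.
have P0 : \prod_i f i != 0 by apply/prodf_neq0 => i _; case: (hf i).
have szG : (1 < size G)%N.
  by rewrite /G size_MXaddC (negbTE P0) ltnS size_poly_gt0.
have [g irrg gG] := irreducible_factor szG.
have [F _ [al rg gen]] := irredp_FAdjoin irrg.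
have rG : (map_poly (in_alg F) G).[al] = 0.
  apply/eqP; rewrite -/(root _ _); have /dvdpP[h ->] := gG.
  by rewrite rmorphM rootM rg orbT.
(* The constant term of [G] is 1; the factor 'X was inserted for this. *)
have al0 : al != 0.
  apply: contra_eq_neq rG => ->; rewrite rmorphD rmorphM /= map_polyX map_polyC.
  by rewrite hornerMXaddC mulr0 add0r /= scale1r oner_neq0.
have mN : modular_maximal (N F al).
  apply: cycle_ann_maximal => // k.
  have : k \in <<1; al>>%VS by rewrite gen memvf.
  by case/Fadjoin_polyP => q /polyOver1P[h ->] ->; exists h.
have [i ci] := clN _ mN.
have [_ /(_ (ex_intro _ g _))[]] := hf i.
  by split; [exact: irredp_neq0|exists F, al].
move=> fi0 [F' [al' [al0' rf mN' ci']]].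
have [b hb] := clI _ _ _ mN' mN ci' ci.
(* Being in the class of [f i], the element [al] is a root of [f i], which divides G - 1, as well as
   of [G]. *)
have := cycle_ann_root hc ec al0' al0 hb (eqP rf) => {}rf.
have := rG; rewrite rmorphD rmorphM /= map_polyX map_polyC hornerMXaddC.
rewrite (bigD1 i) //= rmorphM hornerM rf !mul0r add0r /= scale1r => /eqP.
by rewrite oner_eq0.
Qed.

Lemma mkseq_add (T : Type) (f : nat -> T) m n :
  mkseq f (m + n) = mkseq f m ++ mkseq (fun i => f (m + i)%N) n.
Proof.
rewrite /mkseq iotaD map_cat add0n; congr (_ ++ _).
by rewrite -[in LHS](addn0 m) iotaDl -map_comp.
Qed.

(** * Branches of a binary tree in the graph *)

Section BinaryTree.
Variables (E : digraph) (K : fieldType) (X : set (vertex E)).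
Variables (e0 : edge E) (hd : vertex E -> seq (edge E)) (br : vertex E -> bool -> edge E).
Hypothesis hX : forall w, X w -> [/\ br w true <> br w false,
  forall b, vpath w (rcons (hd w) (br w b)) (erange (br w b)) &
  forall b, X (erange (br w b))].

Fixpoint tree_path w (bs : seq bool) : seq (edge E) :=
  if bs is b :: bs' then rcons (hd w) (br w b) ++ tree_path (erange (br w b)) bs' else [::].

Fixpoint tree_end w (bs : seq bool) : vertex E :=
  if bs is b :: bs' then tree_end (erange (br w b)) bs' else w.

Lemma tree_path_cat w bs bs' :
  tree_path w (bs ++ bs') = tree_path w bs ++ tree_path (tree_end w bs) bs'.
Proof. by elim: bs w => //= b bs IH w; rewrite IH catA. Qed.

Lemma tree_path_size w bs : (size bs <= size (tree_path w bs))%N.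
Proof.
elim: bs w => //= b bs IH w; rewrite size_cat size_rcons addSn ltnS.
exact: leq_trans (IH _) (leq_addl _ _).
Qed.

Lemma tree_endP w bs : X w -> X (tree_end w bs) /\ vpath w (tree_path w bs) (tree_end w bs).
Proof.
elim: bs w => [|b bs IH] w Xw /=; first by rewrite eqxx.
have [_ hp hx] := hX Xw; have [Xe he] := IH _ (hx b); split=> //.
by apply/vpath_cat; exists (erange (br w b)).
Qed.

Variable w0 : vertex E.
Hypothesis Xw0 : X w0.
Implicit Types omega : nat -> bool.

Definition branch omega : nat -> edge E :=
  fun n => nth e0 (tree_path w0 (mkseq omega n.+1)) n.

Lemma branch_nth omega k i : (i < size (tree_path w0 (mkseq omega k)))%N ->
  branch omega i = nth e0 (tree_path w0 (mkseq omega k)) i.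
Proof.
move=> ik; rewrite /branch.
have ii : (i < size (tree_path w0 (mkseq omega i.+1)))%N.
  by apply: leq_trans (tree_path_size _ _); rewrite size_mkseq.
have [/subnK <-|/ltnW/subnK <-] := leqP i.+1 k.
  by rewrite addnC mkseq_add tree_path_cat nth_cat ii.
by rewrite addnC mkseq_add tree_path_cat nth_cat ik.
Qed.

Lemma valid_branch omega : valid (branch omega).
Proof.
move=> n; have sz : (n.+1 < size (tree_path w0 (mkseq omega n.+2)))%N.
  by apply: leq_trans (tree_path_size _ _); rewrite size_mkseq.
rewrite (branch_nth (ltnW sz)) (branch_nth sz).
by apply: vpath_nth sz; have [_] := tree_endP (mkseq omega n.+2) Xw0; exact.
Qed.

Lemma mkseq_branch omega m :
  mkseq (branch omega) m = take m (tree_path w0 (mkseq omega m)).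
Proof.
have sz : (m <= size (tree_path w0 (mkseq omega m)))%N.
  by apply: leq_trans (tree_path_size _ _); rewrite size_mkseq.
apply: (@eq_from_nth _ e0); rewrite size_mkseq ?size_takel // => i im.
by rewrite nth_mkseq // nth_take // (@branch_nth _ m) // (leq_trans im).
Qed.

(** At the first bit where they differ, both branches have followed the same tree path and the same
    [hd], and then take the two different edges. *)
Lemma branch_inj : injective branch.
Proof.
move=> om om' e; apply/funext => k; apply/eqP/negPn/negP.
have [n] := ubnP k; elim: n k => // n IH k kn ne.
have pre : mkseq om k = mkseq om' k.
  apply: (@eq_from_nth _ true); rewrite !size_mkseq // => i ik.
  rewrite !nth_mkseq //; apply/eqP/negPn/negP; apply: IH.
  exact: leq_trans ik _.
set bs := mkseq om k; pose u := tree_end w0 bs.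
have nthE o : mkseq o k = bs ->
    branch o (size (tree_path w0 bs) + size (hd u)) = br u (o k).
  move=> ho; rewrite (@branch_nth _ k.+1) mkseqS -cats1 tree_path_cat ho -/u /= cats0.
    by rewrite nth_cat ltnNge leq_addr /= addKn nth_rcons ltnn eqxx.
  by rewrite size_cat ltn_add2l size_rcons.
have [Xu _] := tree_endP bs Xw0; have [ne_br _ _] := hX Xu.
have := nthE om erefl; rewrite e (nthE om' (esym pre)) => h.
by move: ne h; case: (om k); case: (om' k) => // _ h; apply: ne_br.
Qed.

Lemma branch_ann_maximal omega :
  @modular_maximal (lpa E K) (delta_ann (idfun : {rmorphism K -> K}) (fun=> 1) (branch omega)).
Proof.
have wt0 : forall e : edge E, (fun=> 1 : K) e != 0 by move=> e; exact: oner_neq0.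
apply: delta_ann_maximal => //; first exact: valid_branch.
move=> k; exists (k *: lvert K (esource (branch omega 0%N))).
apply/funext => q; rewrite actZ // act_vert_delta //; last exact: valid_branch.
by rewrite (delta_scale1 _ k).
Qed.

(* A tail class meets the branches of the tree in a countable set, since a branch is a
   finite tree path followed by a tail of a fixed representative; Cantor's diagonal
   then gives a branch outside finitely many classes. *)
Lemma not_finitely_many_of_tree : ~ finitely_many_simple_left_modules (lpa E K).
Proof.
move=> /finitely_many_classes[n [cl [clN clI]]].
have wt0 : forall e : edge E, (fun=> 1 : K) e != 0 by move=> e; exact: oner_neq0.
pose N omega := @delta_ann E K K (idfun : {rmorphism K -> K}) (fun=> 1) (branch omega).
have /choice[r hr] i : exists o, forall om, cl (N om) i -> cl (N o) i.
  have [[o ho]|no] := pselect (exists o, cl (N o) i); first by exists o.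
  by exists xpredT => om h; case: no; exists om.
(* A code records a class, the two offsets of a tail equivalence with its representative, and the
   bits that produce the initial segment. *)
pose dec (x : 'I_n * nat * nat * seq bool) : nat -> edge E :=
  icat (take x.1.1.2 (tree_path w0 x.2)) (idrop x.1.2 (branch (r x.1.1.1))).
have decP om : exists x, dec x = branch om.
  have [i ci] := clN _ (branch_ann_maximal om).
  have [b hb] := clI _ _ _ (branch_ann_maximal om) (branch_ann_maximal (r i)) ci (hr i om ci).
  have [[m [l ml]] _] := delta_ann_compare wt0 wt0 (valid_branch om) (valid_branch (r i)) hb.
  exists (i, m, l, mkseq om m).
  by rewrite /dec /= -ml -mkseq_branch icat_mkseq.
pose g x : nat -> bool :=
  if pselect (exists o, branch o = dec x) is left h then projT1 (cid h) else xpredT.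
have gP om : exists x, g x = om.
  have [x ex] := decP om; exists x; rewrite /g.
  case: pselect => [h|[]]; last by exists om.
  by case: cid => o /= eo; apply: branch_inj; rewrite eo.
(* Codes form a countable type, so their numbering by [pickle] serves as the index of the
   diagonal. *)
pose d k := if unpickle k is Some x then ~~ g x k else true.
have [x gx] := gP d.
have : d (pickle x) = ~~ g x (pickle x) by rewrite /d pickleK.
by rewrite gx; case: (d _).
Qed.

End BinaryTree.

Lemma not_finitely_many_of_branching (E : digraph) (K : fieldType) (X : set (vertex E)) :
  X !=set0 -> branching X -> ~ finitely_many_simple_left_modules (lpa E K).
Proof.
move=> [w0 Xw0] bX; have [_ [e0 _]] := bX w0 Xw0.
have /choice[T hT] w : exists t : seq (edge E) * edge E * edge E, X w ->
    [/\ t.1.2 <> t.2, vpath w t.1.1 (esource t.1.2), esource t.2 = esource t.1.2,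
        X (erange t.1.2) & X (erange t.2)].
  have [Xw|nX] := pselect (X w); last by exists ([::], e0, e0).
  by have [s [e [f h]]] := bX w Xw; exists (s, e, f).
pose br w (b : bool) := if b then (T w).1.2 else (T w).2.
apply: (@not_finitely_many_of_tree E K X e0 (fun w => (T w).1.1) br _ w0 Xw0) => w Xw.
have [ne hs es X1 X2] := hT w Xw; split=> // -[] //=; rewrite -cats1;
  apply/vpath_cat; exists (esource (T w).1.2) => //=; rewrite ?es !eqxx //.
Qed.

(** * The standard involution *)

Section Star.
Variables (E : digraph) (K : fieldType).
Local Notation L := (lpa E K).

Fixpoint term_star (a : lpa_term E K) : lpa_term E K :=
  match a with
  | tvertex v => tvertex K v
  | tedge e => tghost K e
  | tghost e => tedge K e
  | tzero => tzero E K
  | tadd a b => tadd (term_star a) (term_star b)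
  | topp a => topp (term_star a)
  | tscale k a => tscale k (term_star a)
  | tmul a b => tmul (term_star b) (term_star a)
  end.

Lemma term_starK : involutive term_star.
Proof. by elim=> //= [a -> b ->|a ->|k a ->|a -> b ->]. Qed.

Lemma term_star_eq a b : lpa_eq a b -> lpa_eq (term_star a) (term_star b).
Proof.
elim=> {a b} /=.
- by move=> a; exact: lpa_refl.
- by move=> a b _; exact: lpa_sym.
- by move=> a b c _ h _; exact: lpa_trans h.
- by move=> a a' b b' _ ha _ hb; exact: lpa_add_congr.
- by move=> a a' _; exact: lpa_opp_congr.
- by move=> k a a' _; exact: lpa_scale_congr.
- by move=> a a' b b' _ ha _ hb; exact: lpa_mul_congr.
- by move=> a b c; exact: lpa_addA.
- by move=> a b; exact: lpa_addC.
- by move=> a; exact: lpa_add0.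
- by move=> a; exact: lpa_addN.
- by move=> c d a; exact: lpa_scaleA.
- by move=> a; exact: lpa_scale1.
- by move=> c a b; exact: lpa_scaleDr.
- by move=> c d a; exact: lpa_scaleDl.
- by move=> a b c; apply: lpa_sym; exact: lpa_mulA.
- by move=> a b c; exact: lpa_mulDr.
- by move=> a b c; exact: lpa_mulDl.
- by move=> c a b; exact: lpa_scaleAr.
- by move=> c a b; exact: lpa_scaleAl.
- by move=> v; exact: lpa_vertex_idem.
- by move=> v w vw; apply: lpa_vertex_orth => wv; exact: vw.
- by move=> e; exact: lpa_ghost_source.
- by move=> e; exact: lpa_range_ghost.
- by move=> e; exact: lpa_edge_range.
- by move=> e; exact: lpa_source_edge.
- by move=> e; exact: lpa_CK1_same.
- by move=> e f ef; apply: lpa_CK1_diff => fe; exact: ef.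
- move=> v es es0 nd hes.
  have -> : term_star (foldr (fun e t => tadd (tmul (tedge K e) (tghost K e)) t)
      (tzero E K) es) = foldr (fun e t => tadd (tmul (tedge K e) (tghost K e)) t)
      (tzero E K) es.
    by elim: es {es0 nd hes} => //= e es ->.
  exact: lpa_CK2.
Qed.

Definition star (x : L) : opp_rng L := lpa_class (term_star (repr x)).

Lemma star_class a : star (lpa_class a) = lpa_class (term_star a).
Proof. exact/lpa_classE/term_star_eq/lpa_repr_class. Qed.

Lemma starD : {morph star : x y / x + y}.
Proof.
elim/lpa_ind=> a; elim/lpa_ind=> b.
by rewrite -lpa_classD !star_class -lpa_classD.
Qed.

Lemma starM : {morph star : x y / x ** y}.
Proof.
elim/lpa_ind=> a; elim/lpa_ind=> b.
by rewrite -lpa_classM !star_class /= lpa_classM.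
Qed.

Lemma starK : cancel star star.
Proof. by elim/lpa_ind=> a; rewrite !star_class term_starK. Qed.

Lemma left_right_finitely_many :
  finitely_many_simple_left_modules L <-> finitely_many_simple_right_modules L.
Proof.
split.
  apply: (@finitely_many_simple_iso (opp_rng L) L star star) => //.
  - exact: starD.
  - by move=> x y; exact: (starM y x).
  - exact: starK.
  - exact: starK.
apply: (@finitely_many_simple_iso L (opp_rng L) star star) => //.
- exact: starD.
- exact: starM.
- exact: starK.
- exact: starK.
Qed.

End Star.

Theorem theorem4p3 (E : digraph) (K : fieldType) :
  (finitely_many_simple_left_modules (lpa E K) <->
   finitely_many_simple_right_modules (lpa E K)) /\
  (finitely_many_simple_left_modules (lpa E K) <->
   semi_artinian (lpa E K) /\
   finite_set [set I : set (lpa E K) | is_ideal I]%classic).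
Proof.
split; first exact: left_right_finitely_many.
split=> [fin|[sa fi]]; last exact: finitely_many_simple_of_semi_artinian.
have acyE := acyclic_of_finitely_many fin.
have fi : finite_set [set I : set (lpa E K) | is_ideal I].
  apply: finite_ideals => // I x hI nx.
  have [y [z [u [B [nB h]]]]] := reduce_mod acyE hI nx.
  exists y, z, (gap K u B); split=> //.
  by rewrite gap_idem subrr; exact: submod0 (ideal_submod hI).
split=> //; apply: semi_artinian_of_finite_ideals => // I nT.
have [//|[X [X0 bX]]] := socle_or_branching acyE nT.
by case: (not_finitely_many_of_branching X0 bX fin).
Qed.
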